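(* Let $s_1,\dots,s_n\in[s_0,1)$ for some $s_0\in(0,1)$. Suppose that $1<p<n/\bar s$ and let $p_\star=np/(n-p\bar s)$. Then there is a constant $C>0$, depending only on $n,p,p_\star,s_0$, such that for every $u\in V^{p,\mu_{\mathrm{axes}}}(\mathbb R^n|\mathbb R^n)$ $$\|u\|_{L^{p_\star}(\mathbb R^n)}^p\le C\int_{\mathbb R^n}\int_{\mathbb R^n}|u(x)-u(y)|^p\,\mu_{\mathrm{axes}}(x,dy)\,dx.$$
   Context: For $s_1,\dots,s_n\in(0,1)$ and $p>1$: $\bar s=\left(\frac1n\sum_{k=1}^n\frac1{s_k}\right)^{-1}$ is the harmonic mean, and $\mu_{\mathrm{axes}}(x,dy)=\sum_{k=1}^n s_k(1-s_k)|x_k-y_k|^{-1-s_kp}\,dy_k\prod_{i\ne k}\delta_{x_i}(dy_i)$, $x\in\mathbb R^n$. $V^{p,\mu_{\mathrm{axes}}}(\mathbb R^n|\mathbb R^n)$ is the set of measurable $u:\mathbb R^n\to\mathbb R$ with $u\in L^p(\mathbb R^n)$ and $\int_{\mathbb R^n}\int_{\mathbb R^n}|u(y)-u(x)|^p\,\mu_{\mathrm{axes}}(x,dy)\,dx<\infty$. *)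

(* Defs.v *)
From HB Require Import structures.
From mathcomp Require Import all_boot all_order all_algebra.
From mathcomp Require Import all_classical all_reals all_analysis.
From mathcomp Require Import measurable_realfun.

Set Implicit Arguments.
Unset Strict Implicit.
Unset Printing Implicit Defensive.
Import Order.TTheory GRing.Theory Num.Theory.
Import numFieldNormedType.Exports.

Local Open Scope classical_set_scope.
Local Open Scope ring_scope.

(* R^n with the product (= Borel) sigma-algebra. *)
Notation Rn R n := (n.-tuple (measurableTypeR R)).

Section lebesgue_measure_Rn.
Context {R : realType}.
Local Open Scope ereal_scope.

Section cons.
Variables (n : nat) (mu : {sigma_finite_measure set (Rn R n) -> \bar R}).

Definition tcons (z : measurableTypeR R * Rn R n) : Rn R n.+1 :=
  [tuple of z.1 :: z.2].

Lemma measurable_tcons : measurable_fun setT tcons.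
Proof. exact: (measurable_cons measurable_fst measurable_snd). Qed.

Definition lebesgue_cons : set (Rn R n.+1) -> \bar R :=
  pushforward (@lebesgue_measure R \x mu) tcons.

Let lebesgue_cons0 : lebesgue_cons set0 = 0.
Proof. by rewrite /lebesgue_cons /pushforward preimage_set0 measure0. Qed.

Let lebesgue_cons_ge0 A : 0 <= lebesgue_cons A.
Proof. by rewrite /lebesgue_cons /pushforward measure_ge0. Qed.

Let lebesgue_cons_sigma_additive : semi_sigma_additive lebesgue_cons.
Proof.
move=> F mF tF mUF; rewrite /lebesgue_cons /pushforward preimage_bigcup.
apply: measure_semi_sigma_additive.
- by move=> k; rewrite -[X in measurable X]setTI; exact: measurable_tcons.
- apply/trivIsetP => i j _ _ ij; rewrite -preimage_setI.
  by move/trivIsetP : tF => /(_ _ _ I I ij) ->; rewrite preimage_set0.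
- rewrite -preimage_bigcup -[X in measurable X]setTI.
  exact: measurable_tcons.
Qed.

HB.instance Definition _ := isMeasure.Build _ _ _
  lebesgue_cons lebesgue_cons0 lebesgue_cons_ge0 lebesgue_cons_sigma_additive.

Lemma lebesgue_cons_sigma_finite : sigma_finite setT lebesgue_cons.
Proof.
have /sigma_finiteP[F [TF ndF Foo]] := sigma_finiteT (@lebesgue_measure R).
have /sigma_finiteP[G [TG ndG Goo]] := sigma_finiteT mu.
pose c (x : Rn R n.+1) : measurableTypeR R * Rn R n :=
  (thead x, [tuple of behead x]).
have cK : cancel tcons c.
  by move=> [a b]; congr pair; exact/val_inj.
have mc : measurable_fun setT c.
  by apply: measurable_fun_pair; [exact: measurable_tnth|exact: measurable_behead].
exists (fun k => c @^-1` (F k `*` G k)).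
  rewrite -preimage_bigcup (_ : \bigcup_k _ = setT) ?preimage_setT//.
  apply/seteqP; split=> // -[x y] _.
  have [i _ Fix] : (\bigcup_i F i) x by rewrite -TF.
  have [j _ Gjy] : (\bigcup_i G i) y by rewrite -TG.
  exists (maxn i j) => //; split => /=.
    by move: x Fix; exact/subsetPset/ndF/leq_maxl.
  by move: y Gjy; exact/subsetPset/ndG/leq_maxr.
move=> k; have [mF Fk] := Foo k; have [mG Gk] := Goo k; split.
  by rewrite -[X in measurable X]setTI; apply: mc => //; exact: measurableX.
rewrite /lebesgue_cons /pushforward -comp_preimage.
rewrite (_ : c \o tcons = id); last exact/funext.
by rewrite product_measure1E// lte_mul_pinfty// ge0_fin_numE.
Qed.

HB.instance Definition _ := Measure_isSigmaFinite.Build _ _ _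
  lebesgue_cons lebesgue_cons_sigma_finite.

End cons.

Fixpoint lebesgue_Rn (n : nat) : {sigma_finite_measure set (Rn R n) -> \bar R} :=
  match n with
  | 0%N => dirac ([tuple] : Rn R 0)
  | m.+1 => lebesgue_cons (lebesgue_Rn m)
  end.

(* A characterization of Lebesgue measure on R^n. *)
Lemma lebesgue_Rn_box (n : nat) (A : 'I_n -> set (measurableTypeR R)) :
  (forall i, measurable (A i)) ->
  lebesgue_Rn n [set x | forall i, A i (tnth x i)] =
  \prod_(i < n) lebesgue_measure (A i).
Proof.
elim: n A => [|n ih] A mA.
  by rewrite big_ord0 /= diracE mem_set// => -[].
rewrite big_ord_recl -ih//= /lebesgue_cons /pushforward.
rewrite -product_measure1E//; last first.
  rewrite [X in measurable X](_ : _ = \bigcap_(i in [set: 'I_n])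
      (tnth (T:=measurableTypeR R) ^~ i @^-1` A (lift ord0 i))).
    apply: fin_bigcap_measurable => // i _.
    by rewrite -[X in measurable X]setTI; exact: measurable_tnth.
  by apply/seteqP; split=> x /= h i; [move=> _ |]; exact: h.
congr (_ _); apply/seteqP; split=> -[a b] /=.
  move=> h; split; first exact: (h ord0).
  by move=> i; have := h (lift ord0 i); rewrite tnthS.
move=> [h0 h] i; case: (unliftP ord0 i) => [j ->|->]; last exact: h0.
by rewrite tnthS; exact: h.
Qed.

End lebesgue_measure_Rn.

Section axes.
Context {R : realType} {n : nat}.
Implicit Types (s : 'I_n -> R) (p : R) (x : Rn R n) (k : 'I_n).

Definition hmean s : R := (n%:R^-1 * \sum_(k < n) (s k)^-1)^-1.

Definition set_coord x k (t : measurableTypeR R) : Rn R n :=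
  [tuple (if i == k then t else tnth x i) | i < n].

(* Value 0 at t = x_k by the convention 0 `^ r = 0 for r != 0; this is a null
   set. *)
Definition axis_density s p x k (t : R) : R :=
  s k * (1 - s k) * `|(tnth x k : R) - t| `^ (-1 - s k * p).

(* The factor dy_k \prod_(i != k) \d_(x_i)(dy_i) is the image of Lebesgue
   measure on R under t |-> set_coord x k t. *)
Definition mu_axes s p x (A : set (Rn R n)) : \bar R :=
  (\sum_(k < n) \int[lebesgue_measure]_(t in set_coord x k @^-1` A)
     (axis_density s p x k t)%:E)%E.

Lemma measurable_set_coord x k : measurable_fun setT (set_coord x k).
Proof.
apply/measurable_fun_tnthP => i.
rewrite (_ : _ \o _ = fun t => if i == k then t else tnth x i); last first.
  by apply/funext => t /=; rewrite tnth_mktuple.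
by case: (i == k); [exact: measurable_id | exact: measurable_cst].
Qed.

Lemma measurable_axis_density s p x k :
  measurable_fun (setT : set (measurableTypeR R)) (axis_density s p x k).
Proof.
apply: measurable_funM => //.
apply: (measurableT_comp (measurable_powR _)).
by apply: measurableT_comp => //; exact: measurable_funB.
Qed.

Section mu_axes_measure.
Context s p x (s01 : forall k, 0 <= s k <= 1).

Lemma axis_density_ge0 k t : 0 <= axis_density s p x k t.
Proof.
have /andP[s0 s1] := s01 k.
by rewrite /axis_density !mulr_ge0 ?subr_ge0// powR_ge0.
Qed.

Let mu_axes0 : mu_axes s p x set0 = 0%E.
Proof. by rewrite /mu_axes big1// => k _; rewrite preimage_set0 integral_set0. Qed.

Let mu_axes_ge0 A : (0 <= mu_axes s p x A)%E.
Proof.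
apply: sume_ge0 => k _; apply: integral_ge0 => t _.
by rewrite lee_fin axis_density_ge0.
Qed.

Let mu_axes_sigma_additive : semi_sigma_additive (mu_axes s p x).
Proof.
move=> F mF tF mUF.
have mk k A : measurable A -> measurable (set_coord x k @^-1` A).
  by move=> mA; rewrite -[X in measurable X]setTI; exact: measurable_set_coord.
rewrite [X in _ --> X](_ : _ =
    limn (fun m => \sum_(0 <= i < m) mu_axes s p x (F i))%E).
  by apply: is_cvg_ereal_nneg_natsum => k _; exact: mu_axes_ge0.
rewrite [RHS]nneseries_sum//; last first.
  move=> k i *; apply: integral_ge0 => t _.
  by rewrite lee_fin axis_density_ge0.
apply: eq_bigr => k _; rewrite preimage_bigcup ge0_integral_bigcup//=.
- by move=> i; exact: mk.
- apply/measurable_EFinP/measurable_funTS; exact: measurable_axis_density.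
- by move=> t _; rewrite lee_fin axis_density_ge0.
- apply/trivIsetP => i j _ _ ij; rewrite -preimage_setI.
  by move/trivIsetP : tF => /(_ _ _ I I ij) ->; rewrite preimage_set0.
Qed.

HB.instance Definition _ := isMeasure.Build _ _ _
  (mu_axes s p x) mu_axes0 mu_axes_ge0 mu_axes_sigma_additive.

End mu_axes_measure.

End axes.

Section energy_space.
Context {R : realType} {n : nat}.
Implicit Types (s : 'I_n -> R) (p : R) (u : Rn R n -> R).

(* Measurability with respect to the Lebesgue sigma-algebra, the completion of
   the Borel one. *)
Definition lebesgue_measurable_fun u : Prop :=
  forall B : set R, measurable B ->
    completed_algebra_gen (lebesgue_Rn n) (u @^-1` B).

(* For a Lebesgue measurable u, the lower integral over Borel simple functions,
   to which the iterated integral below amounts, agrees with the integral for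
   the completed measures: u is almost everywhere equal to a Borel function and,
   by Fubini, a Lebesgue null set is mu_axes s p x-null for almost every x. *)
Definition V_axes s p : set (Rn R n -> R) :=
  [set u | [/\ lebesgue_measurable_fun u,
               finite_norm (lebesgue_Rn n) p%:E u &
               (\int[lebesgue_Rn n]_x \int[mu_axes s p x]_y
                  (`|u y - u x| `^ p)%:E < +oo)%E]].

End energy_space.

(* Main.v *)
Require Import Defs.
From mathcomp Require Import all_boot all_order all_algebra.
From mathcomp Require Import all_classical all_reals all_analysis.
From mathcomp Require Import measurable_realfun.
From mathcomp Require Import ring lra.

(* For v measurable put Om_k(h) = \int |v(x + h e_k) - v(x)|^p dx; the energy is
   \sum_k s_k (1 - s_k) \int Om_k(h) |h|^(-1 - s_k p) dh.

   Convexity gives Om_k(2h) <= 2^p Om_k(h), so the part of the h-integral over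
   ]0, rho/2] is at least 2^(-p (1 - s_k)) times the part over ]0, rho]. What
   remains for ]rho/2, rho] carries a factor 1 - 2^(-p (1 - s_k)) <= p (1 - s_k):
   the mean of Om_k over ]rho/2, rho] is bounded by rho^(s_k p) times the energy,
   with a constant that does not degenerate as s_k -> 1.

   Suppose w vanishes off A and equals M on B. Average |w(x + h) - w(x)|^p over h
   in the box of sides rho_k / 2 with rho_k = r^(1/s_k) and volume 2 |A|: at least
   half of the points x + h lie off A, and h can be split along the axes, whence
   M^p |B| <= C |A|^(p sbar / n) energy(w).

   Apply this to the truncations of |u| between the levels t_i = c 2^i and 2 t_i,
   whose energies add up to at most the energy of u. With a_i = |{|u| > t_i}| and
   e_i the energy of the i-th truncation, b_i = t_i^q a_i satisfies
   b_(i+1) <= C b_i^(1 - p/q) e_i, and summing over i bounds (\sum_i b_i)^(p/q) by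
   the energy up to a term that vanishes as c -> 0. *)

Set Implicit Arguments.
Unset Strict Implicit.
Unset Printing Implicit Defensive.
Import Order.TTheory GRing.Theory Num.Theory.
Import numFieldNormedType.Exports.

Local Open Scope classical_set_scope.
Local Open Scope ring_scope.

(** * Invariance of Lebesgue measure *)

Section iterated_integrals.
Context d1 d2 (T1 : measurableType d1) (T2 : measurableType d2) {R : realType}.
Variables (m1 : {sigma_finite_measure set T1 -> \bar R})
          (m2 : {sigma_finite_measure set T2 -> \bar R}).
Variable F : T1 -> T2 -> \bar R.
Hypothesis mF : measurable_fun setT (fun z : T1 * T2 => F z.1 z.2).
Hypothesis F0 : forall x y, (0 <= F x y)%E.

Lemma measurable_integral :
  measurable_fun setT (fun x => \int[m2]_y F x y)%E.
Proof. exact: (measurable_fun_fubini_tonelli_F _ mF (fun z => F0 z.1 z.2)). Qed.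

Lemma exchange_integral :
  (\int[m1]_x \int[m2]_y F x y = \int[m2]_y \int[m1]_x F x y)%E.
Proof. exact: (fubini_tonelli _ mF (fun z => F0 z.1 z.2)). Qed.

End iterated_integrals.

Section real_line.
Context {R : realType}.
Local Notation leb := (@lebesgue_measure R).
Local Notation mR := (measurableTypeR R).
Local Open Scope ereal_scope.

Lemma measurable_translate (a : R) : measurable_fun setT ((fun t => (t + a)%R) : mR -> mR).
Proof. exact: measurable_funD. Qed.

(** The pushforward has the right value on every half-open interval, and these values determine
    Lebesgue measure. *)
Lemma lebesgue_measure_translate (a : R) (A : set mR) : measurable A ->
  pushforward leb ((fun t => (t + a)%R) : mR -> mR) A = leb A.
Proof.
move=> mA; apply/esym.
pose h := (fun t => (t + a)%R) : mR -> mR.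
have mh : measurable_fun setT h := measurable_translate a.
apply: (@lebesgue_measure_unique R (pushforward leb h)) => //= _ [[b c]] _ <-.
rewrite /pushforward (_ : _ @^-1` _ = `]b - a, c - a]%classic)%R.
  rewrite !lebesgue_measure_itv/= !lte_fin ltrD2r.
  by case: ifP => // _; rewrite -!EFinB opprD opprK addrACA addNr addr0.
by apply/seteqP; split => x /=; rewrite !in_itv/= lerBrDr ltrBlDr.
Qed.

Lemma ge0_integral_translate (a : R) (f : mR -> \bar R) :
  measurable_fun setT f -> (forall t, 0 <= f t) ->
  \int[leb]_t f (t + a)%R = \int[leb]_t f t.
Proof.
move=> mf f0.
pose h := (fun t => (t + a)%R) : mR -> mR.
have mh : measurable_fun setT h := measurable_translate a.
rewrite [RHS](@eq_measure_integral _ _ _ _ (pushforward leb h)); last first.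
  by move=> A mA _; exact/esym/lebesgue_measure_translate.
by rewrite (ge0_integral_pushforward mh).
Qed.

(** The preimage of $]b, c]$ is $]2b, 2c]$, so half the pushforward agrees with Lebesgue measure on
    half-open intervals. This is the form that the substitution in [ge0_integral_half] calls for. *)
Lemma lebesgue_measure_half (A : set mR) : measurable A ->
  2%:E * leb A = pushforward leb ((fun t => (t / 2)%R) : mR -> mR) A.
Proof.
move=> mA.
pose h := (fun t => (t / 2)%R) : mR -> mR.
have mh : measurable_fun setT h by apply: measurable_funM.
have c0 : (0 <= 2^-1 :> R)%R by rewrite invr_ge0.
have -> : leb A = (2^-1)%:E * pushforward leb h A.
  apply: (@lebesgue_measure_unique R (mscale (NngNum c0) (pushforward leb h))) => //= _ [[b c]] _ <-.
  rewrite /mscale/= /pushforward.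
  rewrite (_ : _ @^-1` _ = `]b * 2, c * 2]%classic)%R; last first.
    by apply/seteqP; split => x /=; rewrite !in_itv/= ltr_pdivlMr// ler_pdivrMr.
  rewrite !lebesgue_measure_itv/= !lte_fin ltr_pM2r//.
  case: ifP => _; last by rewrite mule0.
  by rewrite -!EFinB -EFinM -mulrBl mulrC mulfK.
by rewrite muleA -EFinM divff// mul1e.
Qed.

Lemma ge0_integral_half (f : mR -> \bar R) (D : set mR) :
  measurable D -> measurable_fun D f -> (forall t, 0 <= f t) ->
  \int[leb]_(t in (fun t => (t / 2)%R) @^-1` D) f (t / 2)%R =
  2%:E * \int[leb]_(t in D) f t.
Proof.
move=> mD mf f0.
pose h := (fun t => (t / 2)%R) : mR -> mR.
have mh : measurable_fun setT h by apply: measurable_funM.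
rewrite -[LHS](ge0_integral_pushforward mh leb mD mf); last by move=> *.
have c0 : (0 <= 2 :> R)%R by [].
rewrite -(@ge0_integral_mscale _ _ _ leb D mD (NngNum c0) f)//.
apply: (@eq_measure_integral _ _ _ _ (mscale (NngNum c0) leb) (pushforward leb h)).
by move=> A mA _; rewrite [RHS]lebesgue_measure_half.
Qed.

End real_line.

Section translation_Rn.
Context {R : realType}.
Local Notation mR := (measurableTypeR R).
Local Open Scope ereal_scope.

Definition translate n (z : 'I_n -> R) (x : Rn R n) : Rn R n :=
  [tuple (tnth x i + z i)%R | i < n].

Lemma measurable_translate_Rn n (z : 'I_n -> R) :
  measurable_fun setT (@translate n z).
Proof.
apply/measurable_fun_tnthP => i.
rewrite (_ : _ \o _ = fun x => (tnth x i + z i)%R); last first.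
  by apply/funext => x; rewrite /= tnth_mktuple.
by apply: (measurable_funD (measurable_tnth i)).
Qed.

Lemma integral_RnS n (f : Rn R n.+1 -> \bar R) :
  measurable_fun setT f -> (forall x, 0 <= f x) ->
  \int[lebesgue_Rn n.+1]_x f x =
  \int[lebesgue_measure]_a \int[lebesgue_Rn n]_b f (tcons (a, b)).
Proof.
move=> mf f0.
rewrite -(@fubini_tonelli1 _ _ _ _ _ lebesgue_measure (lebesgue_Rn n)
  (f \o @tcons R n)); last 2 first.
- by apply: measurableT_comp => //; exact: measurable_tcons.
- by move=> x; exact: f0.
apply: (ge0_integral_pushforward (@measurable_tcons R n)) => //.
Qed.

(** Induction on [n] with the first coordinate split off: the induction hypothesis treats the inner
    integral, invariance on the line the outer one. *)
Lemma ge0_integral_translate_Rn n (z : 'I_n -> R) (f : Rn R n -> \bar R) :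
  measurable_fun setT f -> (forall x, 0 <= f x) ->
  \int[lebesgue_Rn n]_x f (translate z x) = \int[lebesgue_Rn n]_x f x.
Proof.
elim: n z f => [|n ih] z f mf f0.
  by apply: eq_integral => x _; congr f; rewrite (tuple0 x) [LHS]tuple0.
have mft : measurable_fun setT (fun x => f (translate z x)).
  by apply: measurableT_comp => //; exact: measurable_translate_Rn.
rewrite integral_RnS; [|exact: mft|by move=> x; exact: f0].
rewrite [RHS]integral_RnS; [|exact: mf|exact: f0].
have mfc : measurable_fun setT (f \o @tcons R n).
  by apply: measurableT_comp => //; exact: measurable_tcons.
rewrite -[RHS](@ge0_integral_translate _ (z ord0)); last 2 first.
- apply: measurable_integral => //.
- by move=> t; exact: integral_ge0.
apply: eq_integral => a _.
rewrite -[RHS](ih (fun i => z (lift ord0 i))).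
- apply: eq_integral => b _; congr f.
  apply: eq_from_tnth => i; rewrite tnth_mktuple.
  case: (unliftP ord0 i) => [j ->|->]; last by rewrite !tnth0.
  by rewrite !tnthS tnth_mktuple.
- by apply: (measurableT_comp mfc); exact: pair1_measurable.
- by [].
Qed.

End translation_Rn.

(** * Integration against the axes measure *)

Section mu_axes_integral.
Context {R : realType} {n : nat}.
Variables (s : 'I_n -> R) (p : R).
Hypothesis s01 : forall k, 0 <= s k <= 1.
Local Notation leb := (@lebesgue_measure R).
Local Notation mR := (measurableTypeR R).
Local Open Scope ereal_scope.
Import HBNNSimple.

(** At each [t] only the value taken by [f] there contributes to the sum over the range; a negative
    [r] has empty preimage. *)
Lemma integral_axis_density_nnsfun x k (f : {nnsfun Rn R n >-> R}) :
  \int[leb]_t ((f (set_coord x k t))%:E * (axis_density s p x k t)%:E) =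
  \sum_(r \in range f) (r%:E *
    \int[leb]_(t in set_coord x k @^-1` (f @^-1` [set r]))
      (axis_density s p x k t)%:E).
Proof.
have mset r : measurable (set_coord x k @^-1` (f @^-1` [set r])).
  rewrite -[X in measurable X]setTI; exact: measurable_set_coord.
have md := measurable_axis_density s p x k.
transitivity (\int[leb]_t \sum_(r \in range f)
   (r%:E * ((EFin \o axis_density s p x k) \_
     (set_coord x k @^-1` (f @^-1` [set r]))) t)).
  apply: eq_integral => t _.
  rewrite (fsbigD1 (f (set_coord x k t)))//=; last by exists (set_coord x k t).
  rewrite fsbig1 ?adde0; last first.
    move=> r [_ /= rf]; rewrite patchE memNset ?mule0//.
    by move=> /= fr; apply: rf.
  by rewrite patchE mem_set.
rewrite ge0_integral_fsum//; last 2 first.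
- move=> r; apply: measurable_funeM.
  apply/(measurable_restrictT _ (mset r)).
  exact/measurable_EFinP/measurable_funTS.
- move=> r t _; have [r0|r0] := leP 0%R r.
    rewrite mule_ge0 ?lee_fin// erestrict_ge0// => ? _.
    by rewrite lee_fin axis_density_ge0.
  rewrite preimage_nnfun0// preimage_set0 patchE memNset// mule0//.
apply: eq_fsbigr => r _; have [r0|r0] := leP 0%R r; last first.
  rewrite preimage_nnfun0// preimage_set0 integral_set0 mule0.
  by apply: integral0_eq => t _; rewrite patchE memNset// mule0.
rewrite ge0_integralZl//.
- by rewrite -integral_mkcond.
- apply/(measurable_restrictT _ (mset r)).
  exact/measurable_EFinP/measurable_funTS.
- by move=> t _; rewrite erestrict_ge0// => ? _; rewrite lee_fin axis_density_ge0.
Qed.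

(** [mu_axes] is given by its values on sets, so the formula is first obtained for simple functions
    by linearity and then passes to [f] by monotone convergence on both sides. *)
Lemma ge0_integral_mu_axes x (f : Rn R n -> \bar R) :
  measurable_fun setT f -> (forall y, 0 <= f y) ->
  \int[mu_axes s p x]_y f y =
  \sum_(k < n) \int[leb]_t (f (set_coord x k t) * (axis_density s p x k t)%:E).
Proof.
move=> mf f0.
pose g := nnsfun_approx measurableT mf.
have g_cvg y : (EFin \o g ^~ y) @ \oo --> f y by exact: cvg_nnsfun_approx.
have g_nd y : {homo g ^~ y : i j / (i <= j)%N >-> (i <= j)%R}.
  by move=> i j ij; exact/lefP/nd_nnsfun_approx.
have md k : measurable_fun setT (fun t : mR => (axis_density s p x k t)%:E).
  by apply/measurable_EFinP; exact: measurable_axis_density.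
have mg i k : measurable_fun setT (fun t : mR => (g i (set_coord x k t))%:E).
  apply/measurable_EFinP; apply: measurableT_comp => //.
  exact: measurable_set_coord.
transitivity (limn (fun i => \int[mu_axes s p x]_y (g i y)%:E)).
  rewrite -monotone_convergence//.
  - by apply: eq_integral => y _; apply/esym/cvg_lim => //; exact: g_cvg.
  - by move=> i; exact/measurable_EFinP.
  - by move=> i y _; rewrite lee_fin.
  - by move=> y _ i j ij; rewrite lee_fin; exact: g_nd.
apply/cvg_lim => //.
rewrite [X in X @ _ --> _](_ : _ = fun i => \sum_(k < n)
   \int[leb]_t ((g i (set_coord x k t))%:E * (axis_density s p x k t)%:E)).
  apply: cvg_nnesum => k _.
    apply: nearW => i; apply: integral_ge0 => t _.
    by rewrite mule_ge0 ?lee_fin// axis_density_ge0.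
  rewrite [X in _ --> X](_ : _ = \int[leb]_t limn (fun i =>
      (g i (set_coord x k t))%:E * (axis_density s p x k t)%:E)); last first.
    apply: eq_integral => t _; apply/esym/cvg_lim => //.
    by apply: cvgeZr => //; exact: g_cvg.
  apply: cvg_monotone_convergence => //.
  - by move=> i; exact: emeasurable_funM.
  - by move=> i t _; rewrite mule_ge0 ?lee_fin// axis_density_ge0.
  - move=> t _ i j ij; apply: lee_wpmul2r; rewrite lee_fin ?axis_density_ge0//.
    exact: g_nd.
apply/funext => i.
rewrite integral_nnsfun// patch_setT sintegralE.
under [RHS]eq_bigr do rewrite integral_axis_density_nnsfun fsbig_finite//=.
rewrite exchange_big fsbig_finite//=; apply: eq_bigr => r _.
have [r0|r0] := leP 0%R r; last first.
  rewrite preimage_nnfun0// /mu_axes !big1 ?mule0// => k _.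
    by rewrite preimage_set0 integral_set0 mule0.
  by rewrite preimage_set0 integral_set0.
rewrite -ge0_sume_distrr// => k _; apply: integral_ge0 => t _.
by rewrite lee_fin axis_density_ge0.
Qed.

End mu_axes_integral.

(** * Dyadic self-similarity *)

Section powR_inequalities.
Context {R : realType}.
Implicit Types a b p x : R.

(** Convexity of $t^p$ at the midpoint of $a$ and $b$, multiplied by $2^p$. *)
Lemma powRD_le_half p a b : 1 <= p -> 0 <= a -> 0 <= b ->
  (a + b) `^ p <= 2 `^ (p - 1) * (a `^ p + b `^ p).
Proof.
move=> p1 a0 b0.
have h1 : (0 <= 2^-1 :> R) && (2^-1 <= 1 :> R) by apply/andP; split; lra.
have := @convex_powR R p p1 (Itv01 (proj1 (andP h1)) (proj2 (andP h1))) a b.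
rewrite !inE/= !in_itv/= a0 b0 => /(_ erefl erefl).
rewrite [X in X `^ _ <= _ -> _]convRE convRE/=.
rewrite (_ : unstable.onem 2^-1 = 2^-1 :> R); last by rewrite /unstable.onem; lra.
rewrite -!mulrDr powRM ?invr_ge0 ?addr_ge0//.
rewrite -powR_inv1// -powRrM mulN1r => h.
rewrite -(@ler_pM2l _ (2 `^ (- p))) ?powR_gt0//.
by rewrite (le_trans h)// mulrA -powRD ?addKr// pnatr_eq0 implybT.
Qed.

(** This is $e^y \ge 1 + y$ at $y = -x \ln 2$, together with $\ln 2 \le 1$. *)
Lemma one_sub_powR2N_le x : 0 <= x -> 1 - 2 `^ (- x) <= x.
Proof.
move=> x0; rewrite /powR pnatr_eq0/=.
have := expR_ge1Dx (- x * ln 2); rewrite mulNr.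
have : ln 2 <= 1 :> R.
  rewrite -[leRHS]expRK ler_ln ?posrE ?expR_gt0//.
  by apply: le_trans (expR_ge1Dx 1); rewrite -natr1 addrC.
nra.
Qed.

End powR_inequalities.

Section dyadic_self_similarity.
Context {R : realType}.
Local Notation leb := (@lebesgue_measure R).
Local Notation mR := (measurableTypeR R).
Local Open Scope ereal_scope.

(* With F the integral over ]0, rho], halving h gives F >= F2 + 2^(-p (1 - s)) F
   where F2 is the part over ]rho/2, rho]; this is where the factor 1 - s comes
   from. *)
Lemma integral_dyadic_le (p s rho : R) (w : mR -> \bar R) :
  (0 < p)%R -> (0 < s < 1)%R -> (0 < rho)%R ->
  measurable_fun setT w -> (forall h, 0 <= w h) ->
  (forall h, w (2 * h)%R <= (2 `^ p)%:E * w h) ->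
  \int[leb]_(h in `](rho / 2)%R, rho]) w h <=
  (rho `^ (1 + s * p) * (p * (1 - s)))%:E *
    \int[leb]_(h in `]0%R, rho]) (w h * (h `^ (- 1 - s * p))%:E).
Proof.
move=> p0 /andP[s0 s1] rho0 mw w0 wdbl.
set W := fun h => w h * (h `^ (- 1 - s * p))%:E.
have mW : measurable_fun setT W.
  by apply: emeasurable_funM => //; apply/measurable_EFinP; exact: measurable_powR.
have W0 h : 0 <= W h by rewrite mule_ge0// lee_fin powR_ge0.
have c0 : (0 < p * (1 - s))%R by rewrite mulr_gt0// subr_gt0.
have WZ (D : set mR) (k : R) : measurable D -> (0 <= k)%R ->
    k%:E * \int[leb]_(h in D) W h = \int[leb]_(h in D) (k%:E * W h).
  move=> mD k0; apply/esym; apply: ge0_integralZl => //; exact: measurable_funTS.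
set F := \int[leb]_(h in `]0%R, rho]) W h.
have F0 : 0 <= F by apply: integral_ge0 => h _; exact: W0.
have /orP[/eqP Foo|Ffin] : (F == +oo) || (F \is a fin_num).
  by case: F F0 => [r| |] //=; rewrite ?orbT.
  by rewrite Foo gt0_muley ?leey// lte_fin mulr_gt0// powR_gt0.
set F1 := \int[leb]_(h in `]0%R, (rho / 2)%R]) W h.
set F2 := \int[leb]_(h in `](rho / 2)%R, rho]) W h.
have FE : F = F1 + F2.
  rewrite /F (@itv_bndbnd_setU _ _ _ (BRight (rho / 2)%R)) ?bnd_simp; [|lra|lra].
  rewrite ge0_integral_setU//=.
  - exact: measurable_funTS.
  - apply/disj_setPS => h [] /=; rewrite !in_itv/= => /andP[_ h1] /andP[h2 _].
    by move: h1; rewrite leNgt h2.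
(* Substitute $h/2$ for $h$. The substitution contributes $2$ and the doubling hypothesis $2^p$;
   with $2^{-p(1-s)}$ these multiply to $2^{1+sp}$, exactly what $(h/2)^{-1-sp}$ gains over
   $h^{-1-sp}$. *)
have F1ge : (2 `^ (- (p * (1 - s))))%:E * F <= F1.
  have : 2%:E * F1 = \int[leb]_(h in `]0%R, rho]) W (h / 2)%R.
    rewrite /F1 -ge0_integral_half//; last exact: measurable_funTS.
    congr (integral _ _ _); apply/seteqP; split => h /=; rewrite !in_itv/=; lra.
  move=> F1E.
  rewrite -(@lee_pmul2l _ 2%:E)// F1E muleA -EFinM.
  rewrite WZ; [|exact: measurable_itv|by rewrite mulr_ge0 ?powR_ge0].
  apply: ge0_le_integral => //.
  - by move=> h _; rewrite mule_ge0// lee_fin mulr_ge0// powR_ge0.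
  - by apply: measurable_funTS; exact: measurable_funeM.
  - apply: measurable_funTS; apply: measurableT_comp => //.
    exact: measurable_funM.
  move=> h; rewrite /= in_itv/= => /andP[h0 hrho]; rewrite /W.
  have -> : w h = w (2 * (h / 2))%R by rewrite mulrC divfK.
  apply: (@le_trans _ _ ((2 * 2 `^ (- (p * (1 - s))))%:E *
      ((2 `^ p)%:E * w (h / 2)%R * (h `^ (- 1 - s * p))%:E))).
    apply: lee_wpmul2l; first by rewrite lee_fin mulr_ge0// powR_ge0.
    by apply: lee_wpmul2r; rewrite ?lee_fin ?powR_ge0.
  rewrite [leLHS](_ : _ = w (h / 2)%R *
      (2 * 2 `^ (- (p * (1 - s))) * 2 `^ p * h `^ (- 1 - s * p))%:E).
    apply: lee_wpmul2l => //; rewrite lee_fin powRM ?invr_ge0 ?(ltW h0)//.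
    rewrite mulrC; apply: ler_wpM2l; first exact: powR_ge0.
    rewrite -{1}(powRr1 (_ : 0 <= 2 :> R)%R)// -!powRD ?pnatr_eq0 ?implybT//.
    rewrite -powR_inv1// -powRrM le_eqVlt; apply/orP; left; apply/eqP.
    by congr (_ `^ _)%R; ring.
  by rewrite (muleAC _ (w _)) -EFinM muleA -EFinM muleC !mulrA.
(* Here [F2 = F - F1], a subtraction that is legitimate because [F] is finite. *)
have F2le : F2 <= (p * (1 - s))%:E * F.
  have F1fin : F1 \is a fin_num.
    by move: Ffin; rewrite FE fin_numD => /andP[].
  have F2fin : F2 \is a fin_num.
    by move: Ffin; rewrite FE fin_numD => /andP[].
  move: F1ge F0; rewrite FE -(fineK F1fin) -(fineK F2fin) -!EFinD -!EFinM !lee_fin.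
  have := one_sub_powR2N_le (ltW c0).
  nra.
(* On $]\rho/2, \rho]$ the weight $h^{-1-sp}$ is at least $\rho^{-1-sp}$. *)
apply: (@le_trans _ _ ((rho `^ (1 + s * p))%:E * F2)); last first.
  by rewrite EFinM -muleA lee_wpmul2l// lee_fin powR_ge0.
rewrite WZ; [|exact: measurable_itv|exact: powR_ge0].
apply: ge0_le_integral => //.
- exact: measurable_funTS.
- by apply: measurable_funTS; exact: measurable_funeM.
move=> h; rewrite /= in_itv/= => /andP[h1 h2].
have h0 : (0 < h)%R by lra.
rewrite /W muleCA -EFinM -[leLHS]mule1; apply: lee_wpmul2l => //.
rewrite lee_fin (_ : - 1 - s * p = - (1 + s * p))%R; last by ring.
rewrite powRN ler_pdivlMr ?powR_gt0// mul1r.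
by rewrite ge0_ler_powR// ?nnegrE ?ltW// addr_gt0// mulr_gt0.
Qed.

End dyadic_self_similarity.

(** * Increments along the axes *)

Section axis_increments.
Context {R : realType} {n : nat}.
Local Notation leb := (@lebesgue_measure R).
Local Notation mR := (measurableTypeR R).
Local Notation lebn := (@lebesgue_Rn R n).
Implicit Types (p : R) (v : Rn R n -> R) (k : 'I_n).

Lemma measurable_powR_dist d (T : measurableType d) p (f g : T -> R) :
  measurable_fun setT f -> measurable_fun setT g ->
  measurable_fun setT (fun z => (`|f z - g z| `^ p)%:E).
Proof.
move=> mf mg; apply/measurable_EFinP.
apply: (measurableT_comp (measurable_powR _)).
by apply: measurableT_comp => //; exact: measurable_funB.
Qed.

Definition axis_shift k (h : mR) (x : Rn R n) : Rn R n :=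
  set_coord x k (tnth x k + h).

Lemma axis_shiftE k h x :
  axis_shift k h x = translate (fun i => if i == k then h else 0) x.
Proof.
apply: eq_from_tnth => i; rewrite !tnth_mktuple.
by case: eqP => [->//|_]; rewrite addr0.
Qed.

Lemma axis_shiftD k h h' x :
  axis_shift k h (axis_shift k h' x) = axis_shift k (h' + h) x.
Proof.
apply: eq_from_tnth => i; rewrite !tnth_mktuple eqxx.
by case: eqP => // _; rewrite addrA.
Qed.

Lemma measurable_axis_shift k :
  measurable_fun setT (fun z : Rn R n * mR => axis_shift k z.2 z.1).
Proof.
apply/measurable_fun_tnthP => i.
have mt j : measurable_fun setT (fun z : Rn R n * mR => tnth z.1 j).
  exact: (measurableT_comp (measurable_tnth j) measurable_fst).
rewrite (_ : _ \o _ = if i == k then fun z => tnth z.1 k + z.2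
                      else fun z => tnth z.1 i); last first.
  by apply/funext => z /=; rewrite tnth_mktuple; case: eqP.
by case: eqP => _; [exact: (measurable_funD (mt k) measurable_snd)|exact: mt].
Qed.

Lemma measurable_axis_shift1 k (h : mR) : measurable_fun setT (axis_shift k h).
Proof. exact: (measurableT_comp (measurable_axis_shift k) (pair2_measurable h)). Qed.

(** This is $Om_k(h)$ of the overview. *)
Definition axis_osc p v k (h : mR) : \bar R :=
  (\int[lebn]_x (`|v (axis_shift k h x) - v x| `^ p)%:E)%E.

Lemma axis_osc_ge0 p v k h : (0 <= axis_osc p v k h)%E.
Proof. by apply: integral_ge0 => x _; rewrite lee_fin powR_ge0. Qed.

Section measurable_v.
Variables (p : R) (v : Rn R n -> R).
Hypothesis mv : measurable_fun setT v.

Lemma measurable_axis_diff k : measurable_fun setT (fun z : Rn R n * mR =>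
  (`|v (axis_shift k z.2 z.1) - v z.1| `^ p)%:E).
Proof.
apply: measurable_powR_dist.
  exact: (measurableT_comp mv (measurable_axis_shift k)).
exact: (measurableT_comp mv measurable_fst).
Qed.

Lemma measurable_axis_diff_swap k : measurable_fun setT (fun z : mR * Rn R n =>
  (`|v (axis_shift k z.1 z.2) - v z.2| `^ p)%:E).
Proof.
have := measurableT_comp (measurable_axis_diff k) (@measurable_swap _ _ mR (Rn R n)).
exact.
Qed.

Lemma measurable_axis_diff_shift k (h : mR) : measurable_fun setT (fun x : Rn R n =>
  (`|v (axis_shift k h x) - v x| `^ p)%:E).
Proof. exact: (measurableT_comp (measurable_axis_diff k) (pair2_measurable h)). Qed.

Lemma measurable_axis_osc k : measurable_fun setT (axis_osc p v k).
Proof.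
apply: (measurable_integral lebn (F := fun h x =>
  (`|v (axis_shift k h x) - v x| `^ p)%:E)).
  exact: measurable_axis_diff_swap.
by move=> *; rewrite lee_fin powR_ge0.
Qed.

(* The constant 2^p is sharp; with a larger one the factor 1 - s in
   integral_dyadic_le would be lost. *)
Lemma axis_osc_double k h : 1 <= p ->
  (axis_osc p v k (2 * h)%R <= (2 `^ p)%:E * axis_osc p v k h)%E.
Proof.
move=> p1.
have m1 := measurable_axis_diff_shift k h.
have d0 x : (0 <= (`|v (axis_shift k h x) - v x| `^ p)%:E)%E.
  by rewrite lee_fin powR_ge0.
have m2 : measurable_fun setT (fun x : Rn R n =>
   (`|v (axis_shift k h (axis_shift k h x)) - v (axis_shift k h x)| `^ p)%:E).
  exact: (measurableT_comp m1 (measurable_axis_shift1 k h)).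
(* The increment over $2h$ is a sum of two increments over $h$ with equal integrals, by translation
   invariance. Convexity costs $2^{p-1}$ and the two equal terms give the remaining factor $2$. *)
have -> : ((2 `^ p)%:E * axis_osc p v k h =
    \int[lebn]_x ((2 `^ (p - 1))%:E *
     ((`|v (axis_shift k h (axis_shift k h x)) - v (axis_shift k h x)| `^ p)%:E +
     (`|v (axis_shift k h x) - v x| `^ p)%:E)))%E.
  rewrite ge0_integralZl//; last 2 first.
  - exact: emeasurable_funD.
  - by move=> x _; rewrite adde_ge0// lee_fin powR_ge0.
  rewrite ge0_integralD//.
  have -> : (\int[lebn]_x (`|v (axis_shift k h (axis_shift k h x)) -
      v (axis_shift k h x)| `^ p)%:E = axis_osc p v k h)%E.
    apply: (etrans _ (ge0_integral_translate_Rn (fun i => if i == k then h else 0) m1 d0)).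
    by apply: eq_integral => x _; rewrite -axis_shiftE.
  set O := axis_osc p v k h.
  have -> : (O + O = 2%:E * O)%E.
    by rewrite -[in LHS](mul1e O) -ge0_muleDl ?lee_fin.
  rewrite muleA -EFinM -{2}[in RHS](powRr1 (_ : 0 <= 2 :> R))// -powRD ?subrK//.
  by rewrite pnatr_eq0 implybT.
apply: ge0_le_integral => //.
- exact: measurable_axis_diff_shift.
- by apply: measurable_funeM; exact: emeasurable_funD.
move=> x _; rewrite -EFinD -EFinM lee_fin.
rewrite (le_trans _ (powRD_le_half _ _ _))//.
rewrite ge0_ler_powR ?nnegrE//; first exact: le_trans p1.
rewrite axis_shiftD -mulr2n mulr_natl.
by rewrite (le_trans _ (ler_normD _ _))// addrA subrK.
Qed.

End measurable_v.

Section mu_axes_fubini.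
Variables (s : 'I_n -> R) (p : R) (F : Rn R n -> Rn R n -> \bar R).
Hypothesis s01 : forall k, 0 <= s k <= 1.
Hypothesis mF : measurable_fun setT (fun z : Rn R n * Rn R n => F z.1 z.2).
Hypothesis F0 : forall x y, (0 <= F x y)%E.

Let W k (h : mR) : \bar R := (`|h| `^ (-1 - s k * p))%:E.

Let mW k : measurable_fun setT (W k).
Proof.
apply/measurable_EFinP; apply: (measurableT_comp (measurable_powR _)).
exact: normr_measurable.
Qed.

Let W0 k h : (0 <= W k h)%E.
Proof. by rewrite lee_fin powR_ge0. Qed.

Let c0 k : (0 <= (s k * (1 - s k))%:E)%E.
Proof. by have /andP[? ?] := s01 k; rewrite lee_fin mulr_ge0// subr_ge0. Qed.

Let G k (x : Rn R n) (h : mR) :=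
  ((s k * (1 - s k))%:E * (F x (axis_shift k h x) * W k h))%E.

Let G0 k x h : (0 <= G k x h)%E.
Proof. by apply: mule_ge0; [exact: c0|apply: mule_ge0; [exact: F0|exact: W0]]. Qed.

Let mFs k : measurable_fun setT (fun z : Rn R n * mR =>
  F z.1 (axis_shift k z.2 z.1)).
Proof.
have := measurableT_comp mF
  (measurable_fun_pair (@measurable_fst _ _ (Rn R n) mR) (measurable_axis_shift k)).
exact.
Qed.

Let mG k : measurable_fun setT (fun z : Rn R n * mR => G k z.1 z.2).
Proof.
apply: measurable_funeM; apply: emeasurable_funM; first exact: mFs.
exact: (measurableT_comp (mW k) measurable_snd).
Qed.

(** Substituting $t = x_k + h$ turns the density into a weight in $h$ alone. The measure of
    integration then no longer depends on $x$, and Tonelli becomes applicable. *)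
Let integral_mu_axesE x :
  (\int[mu_axes s p x]_y F x y = \sum_(k < n) \int[leb]_h G k x h)%E.
Proof.
have mFx : measurable_fun setT (F x).
  exact: (measurableT_comp mF (pair1_measurable x)).
rewrite (ge0_integral_mu_axes _ s01 _ mFx)//.
apply: eq_bigr => k _.
rewrite -[LHS](@ge0_integral_translate _ (tnth x k)); last 2 first.
- apply: emeasurable_funM.
    by apply: (measurableT_comp mFx); exact: measurable_set_coord.
  by apply/measurable_EFinP; exact: measurable_axis_density.
- move=> t; rewrite mule_ge0 ?lee_fin//.
  exact: axis_density_ge0.
apply: eq_integral => h _; rewrite /G /W /axis_density /axis_shift.
rewrite (addrC h) opprD addNKr normrN.
by rewrite EFinM muleCA.
Qed.

Lemma measurable_integral_mu_axes :
  measurable_fun setT (fun x => \int[mu_axes s p x]_y F x y)%E.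
Proof.
under eq_fun do rewrite integral_mu_axesE.
by apply: emeasurable_sum => k; exact: (measurable_integral leb (mG k) (G0 k)).
Qed.

(** Tonelli exchanges $x$ and $h$ on each axis. A general [F] serves both the energy and, as the
    indicator of a null set in [y], [null_mu_axes]. *)
Lemma integral_mu_axes_shift :
  (\int[lebn]_x \int[mu_axes s p x]_y F x y =
   \sum_(k < n) (s k * (1 - s k))%:E *
     \int[leb]_h ((\int[lebn]_x F x (axis_shift k h x)) *
                  (`|h| `^ (-1 - s k * p))%:E))%E.
Proof.
under eq_integral do rewrite integral_mu_axesE.
rewrite ge0_integral_sum//; last 2 first.
- by move=> k; exact: (measurable_integral leb (mG k) (G0 k)).
- by move=> k x _; apply: integral_ge0 => h _.
apply: eq_bigr => k _.
rewrite (exchange_integral lebn leb (mG k) (G0 k)).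
have mFk : measurable_fun setT (fun h : mR => \int[lebn]_x F x (axis_shift k h x))%E.
  apply: (measurable_integral lebn (F := fun h x => F x (axis_shift k h x))) => //.
  exact: (measurableT_comp (mFs k) (@measurable_swap _ _ mR (Rn R n))).
transitivity (\int[leb]_h ((s k * (1 - s k))%:E *
   ((\int[lebn]_x F x (axis_shift k h x)) * W k h)))%E.
  apply: eq_integral => h _; rewrite /G.
  have m1 : measurable_fun setT (fun x => F x (axis_shift k h x)).
    exact: (measurableT_comp (mFs k) (pair2_measurable h)).
  rewrite ge0_integralZl//; last 2 first.
  - by apply: emeasurable_funM.
  - by move=> x _; apply: mule_ge0.
  by rewrite ge0_integralZr.
rewrite ge0_integralZl//.
- exact: emeasurable_funM.
- by move=> h _; rewrite mule_ge0//; apply: integral_ge0.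
Qed.

End mu_axes_fubini.

Lemma energy_mu_axes (s : 'I_n -> R) p v :
  (forall k, 0 <= s k <= 1) -> measurable_fun setT v ->
  (\int[lebn]_x \int[mu_axes s p x]_y (`|v x - v y| `^ p)%:E =
   \sum_(k < n) (s k * (1 - s k))%:E *
     \int[leb]_h (axis_osc p v k h * (`|h| `^ (-1 - s k * p))%:E))%E.
Proof.
move=> s01 mv.
have oscE k h : (\int[lebn]_x (`|v x - v (axis_shift k h x)| `^ p)%:E =
    axis_osc p v k h)%E.
  by apply: eq_integral => x _; rewrite distrC.
rewrite (integral_mu_axes_shift _ s01 (F := fun x y => (`|v x - v y| `^ p)%:E)).
- by apply: eq_bigr => k _; under eq_integral do rewrite oscE.
- by apply: measurable_powR_dist; exact: (measurableT_comp mv).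
- by move=> x y; rewrite lee_fin powR_ge0.
Qed.

End axis_increments.

(** * Averages over boxes *)

Section product_integrals.
Context {R : realType}.
Local Notation leb := (@lebesgue_measure R).
Local Notation mR := (measurableTypeR R).
Local Open Scope ereal_scope.

Lemma integral_mkcond_indic d (T : measurableType d)
    (mu : {measure set T -> \bar R}) (D : set T) (f : T -> \bar R) :
  \int[mu]_(x in D) f x = \int[mu]_x (f x * (\1_D x)%:E).
Proof.
rewrite integral_mkcond; apply: eq_integral => x _.
by rewrite patchE indicE; case: ifP => _; rewrite ?mule1 ?mule0.
Qed.

Lemma integral_cst_indic d (T : measurableType d)
    (mu : {measure set T -> \bar R}) (A : set T) (c : R) :
  (0 <= c)%R -> measurable A ->
  \int[mu]_x (c%:E * (\1_A x)%:E) = c%:E * mu A.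
Proof.
move=> c0 mA; rewrite ge0_integralZl; first by rewrite integral_indic// setIT.
- exact: measurableT.
- by apply/measurable_EFinP; exact: measurable_indic.
- by move=> x _; rewrite lee_fin.
- by rewrite lee_fin.
Qed.

Lemma measurable_prod_tnth n (phi : 'I_n -> mR -> \bar R) :
  (forall i, measurable_fun setT (phi i)) ->
  measurable_fun setT (fun x : Rn R n => \prod_(i < n) phi i (tnth x i)).
Proof.
move=> mphi; elim: (index_enum _) => [|i r ih].
  by under eq_fun do rewrite big_nil; exact: measurable_cst.
under eq_fun do rewrite big_cons; apply: emeasurable_funM => //.
exact: (measurableT_comp (mphi i) (measurable_tnth i)).
Qed.

Lemma integral_prod_tnth n (phi : 'I_n -> mR -> \bar R) :
  (forall i, measurable_fun setT (phi i)) -> (forall i t, 0 <= phi i t) ->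
  \int[lebesgue_Rn n]_x (\prod_(i < n) phi i (tnth x i)) =
  \prod_(i < n) \int[leb]_t phi i t.
Proof.
elim: n phi => [|n ih] phi mphi phi0.
  rewrite big_ord0 /=; under eq_integral do rewrite big_ord0.
  by rewrite integral_cst// mul1e /= diracE mem_set.
have m' := measurable_prod_tnth (fun i => mphi (lift ord0 i)).
rewrite integral_RnS; last 2 first.
- exact: measurable_prod_tnth.
- by move=> x; apply: prode_ge0.
rewrite big_ord_recl -ih//.
rewrite -ge0_integralZr//; last first.
  by apply: integral_ge0 => x _; apply: prode_ge0.
apply: eq_integral => t _.
rewrite -ge0_integralZl//; last by move=> x _; apply: prode_ge0.
apply: eq_integral => x _; rewrite big_ord_recl tnth0; congr (_ * _).
by apply: eq_bigr => i _; rewrite tnthS.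
Qed.

(** The indicator of a box is a product over the coordinates; multiplying its [k]-th factor by [g]
    keeps the product form that [integral_prod_tnth] integrates. *)
Lemma integral_box_coord n (I : 'I_n -> set mR) k (g : mR -> \bar R) :
  (forall i, measurable (I i)) ->
  measurable_fun setT g -> (forall t, 0 <= g t) ->
  \int[lebesgue_Rn n]_(x in [set x | forall i, I i (tnth x i)]) g (tnth x k) =
  \prod_(i < n | i != k) leb (I i) * \int[leb]_(t in I k) g t.
Proof.
move=> mI mg g0.
pose phi i := (if i == k then g else cst 1) \_ (I i).
have mphi i : measurable_fun setT (phi i).
  apply/(measurable_restrictT _ (mI i)).
  by case: (i == k); [exact: measurable_funTS|exact: measurable_cst].
have phi0 i t : 0 <= phi i t.
  by apply: erestrict_ge0 => {}t _; case: (i == k).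
transitivity (\int[lebesgue_Rn n]_x (\prod_(i < n) phi i (tnth x i))).
  rewrite integral_mkcond; apply: eq_integral => x _.
  rewrite patchE; case: ifPn => [/[!inE] xI|/negP].
    rewrite (bigD1 k)//= big1 ?mule1; last first.
      by move=> i /negPf ik; rewrite /phi ik patchE mem_set.
    by rewrite /phi eqxx patchE mem_set.
  rewrite inE/= => /existsNP[i xi].
  by rewrite (bigD1 i)//= /phi patchE memNset// mul0e.
rewrite integral_prod_tnth// (bigD1 k)//= muleC; congr (_ * _).
  apply: eq_bigr => i /negPf ik; rewrite /phi ik -integral_mkcond.
  by rewrite integral_cst// mul1e.
by rewrite /phi eqxx -integral_mkcond.
Qed.

End product_integrals.

Section box_averages.
Context {R : realType} {n : nat}.
Local Notation leb := (@lebesgue_measure R).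
Local Notation mR := (measurableTypeR R).
Local Notation lebn := (@lebesgue_Rn R n).

(** The sum is at most $n$ times its largest term $a_j$, and $a_j^p$ occurs on the right. *)
Lemma powR_sum_le p (a : 'I_n -> R) : 0 < p -> (forall i, 0 <= a i) ->
  (\sum_(i < n) a i) `^ p <= n%:R `^ p * \sum_(i < n) a i `^ p.
Proof.
move=> p0 a0; have [[i0 _]|n0] := pselect (exists i : 'I_n, True); last first.
  rewrite !big1 ?mulr0//; [|by move=> i; case: n0; exists i..].
  by rewrite powR0// gt_eqF.
pose j := [arg max_(i > i0) a i]%O.
have aj i : a i <= a j by rewrite /j; case: Order.TotalTheory.arg_maxP => // j' _; exact.
have h : \sum_(i < n) a i <= n%:R * a j.
  rewrite -[n in leRHS]card_ord -sum1_card natr_sum mulr_suml.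
  by apply: ler_sum => i _; rewrite mul1r.
apply: (@le_trans _ _ ((n%:R * a j) `^ p)).
  by rewrite ge0_ler_powR// ?(ltW p0)// ?nnegrE ?mulr_ge0// sumr_ge0.
rewrite powRM// ler_wpM2l ?powR_ge0// (bigD1 j)//= lerDl sumr_ge0// => i _.
exact: powR_ge0.
Qed.

Variables (p : R) (w : Rn R n -> R).
Hypothesis p1 : 1 <= p.
Hypothesis mw : measurable_fun setT w.

(** The [m]-th vertex of the path from [x] to [x + h] that follows the axes one after the other. *)
Definition partial_shift (h : Rn R n) (m : nat) : Rn R n -> Rn R n :=
  translate (fun i => if (i < m)%N then tnth h i else 0).

Lemma partial_shift0 h x : partial_shift h 0 x = x.
Proof. by apply: eq_from_tnth => i; rewrite tnth_mktuple addr0. Qed.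

Lemma partial_shiftT h x : partial_shift h n x = translate (tnth h) x.
Proof. by apply: eq_from_tnth => i; rewrite !tnth_mktuple ltn_ord. Qed.

Lemma partial_shiftS h (k : 'I_n) x :
  partial_shift h k.+1 x = axis_shift k (tnth h k) (partial_shift h k x).
Proof.
apply: eq_from_tnth => i; rewrite !tnth_mktuple ltnn addr0 ltnS leq_eqVlt.
rewrite -val_eqE; case: (eqVneq (val i) (val k)) => [/val_inj ->//|ik].
by rewrite orFb.
Qed.

Lemma measurable_dist_translate :
  measurable_fun setT (fun z : Rn R n * Rn R n =>
    (`|w (translate (tnth z.1) z.2) - w z.2| `^ p)%:E).
Proof.
apply: measurable_powR_dist; last exact: (measurableT_comp mw measurable_snd).
apply: (measurableT_comp mw); apply/measurable_fun_tnthP => i.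
rewrite (_ : _ \o _ = fun z => tnth z.2 i + tnth z.1 i); last first.
  by apply/funext => z /=; rewrite tnth_mktuple.
apply: (measurable_funD
  (measurableT_comp (measurable_tnth i) measurable_snd)
  (measurableT_comp (measurable_tnth i) measurable_fst)).
Qed.

(** The difference telescopes along the vertices of the path. In each term the starting vertex is a
    fixed translate of [x], which translation invariance removes. *)
Lemma integral_translate_le_axis_osc (h : Rn R n) :
  (\int[lebn]_x (`|w (translate (tnth h) x) - w x| `^ p)%:E <=
   (n%:R `^ p)%:E * \sum_(k < n) axis_osc p w k (tnth h k))%E.
Proof.
have p0 : 0 < p := lt_le_trans ltr01 p1.
pose d k x := (`|w (axis_shift k (tnth h k) (partial_shift h k x)) -
                 w (partial_shift h k x)| `^ p)%:E.
have md k : measurable_fun setT (d k).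
  apply: (measurableT_comp (measurable_axis_diff_shift p mw k (tnth h k))).
  exact: measurable_translate_Rn.
have -> : (\sum_(k < n) axis_osc p w k (tnth h k) =
           \int[lebn]_x \sum_(k < n) d k x)%E.
  rewrite ge0_integral_sum; [|exact: measurableT|exact: md|
    by move=> k x _; rewrite lee_fin powR_ge0].
  apply: eq_bigr => k _; apply/esym.
  apply: (@ge0_integral_translate_Rn _ _ _
    (fun x => (`|w (axis_shift k (tnth h k) x) - w x| `^ p)%:E)).
    exact: measurable_axis_diff_shift.
  by move=> x; rewrite lee_fin powR_ge0.
have mD : measurable_fun setT (fun x => \sum_(k < n) d k x)%E.
  by apply: emeasurable_sum.
rewrite -ge0_integralZl; [|exact: measurableT|exact: mD| |]; last 2 first.
- by move=> x _; apply: sume_ge0 => k _; rewrite lee_fin powR_ge0.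
- by rewrite lee_fin powR_ge0.
apply: ge0_le_integral; [exact: measurableT|..].
- by move=> x _; rewrite lee_fin powR_ge0.
- exact: (measurableT_comp measurable_dist_translate (pair1_measurable h)).
- exact: measurable_funeM.
move=> x _; rewrite sumEFin -EFinM lee_fin.
apply: le_trans (powR_sum_le p0 _); last by move=> k; exact: normr_ge0.
rewrite ge0_ler_powR ?(ltW p0) ?nnegrE ?sumr_ge0//.
rewrite -partial_shiftT -{2}(partial_shift0 h x).
under eq_bigr do rewrite -partial_shiftS.
rewrite -(telescope_sumr (fun m => w (partial_shift h m x)))//.
by rewrite big_mkord ler_norm_sum.
Qed.

(** For [x] in [B], the [h] with [x + h] in [A] form a translate of [A], of measure at most [a], so
    they leave at least half of [Q]. On that remainder the increment is exactly [M] in absolute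
    value; integrate over [B] after exchanging [h] and [x]. *)
Lemma integral_box_dist_ge (Q A B : set (Rn R n)) (M a : R) :
  measurable Q -> measurable A -> measurable B ->
  lebn Q = (2 * a)%:E -> (lebn A <= a%:E)%E -> 0 <= a -> 0 <= M ->
  (forall x, ~ A x -> w x = 0) -> (forall x, B x -> w x = M) ->
  ((M `^ p * a)%:E * lebn B <=
   \int[lebn]_(h in Q) \int[lebn]_x (`|w (translate (tnth h) x) - w x| `^ p)%:E)%E.
Proof.
move=> mQ mA mB Qa Aa a0 M0 wA wB.
pose F (h x : Rn R n) := ((`|w (translate (tnth h) x) - w x| `^ p)%:E * (\1_Q h)%:E)%E.
have F0 h x : (0 <= F h x)%E by rewrite mule_ge0// lee_fin ?powR_ge0.
have mF : measurable_fun setT (fun z : Rn R n * Rn R n => F z.1 z.2).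
  apply: emeasurable_funM; first exact: measurable_dist_translate.
  apply/measurable_EFinP; apply: (measurableT_comp _ measurable_fst).
  exact: measurable_indic.
have mF' : measurable_fun setT (fun z : Rn R n * Rn R n => F z.2 z.1).
  exact: (measurableT_comp mF (@measurable_swap _ _ (Rn R n) (Rn R n))).
have -> : (\int[lebn]_(h in Q) \int[lebn]_x
    (`|w (translate (tnth h) x) - w x| `^ p)%:E =
    \int[lebn]_x \int[lebn]_h F h x)%E.
  rewrite integral_mkcond_indic -(exchange_integral lebn lebn mF F0).
  apply: eq_integral => h _; rewrite -ge0_integralZr//.
  exact: (measurableT_comp measurable_dist_translate (pair1_measurable h)).
have FB x : B x -> ((M `^ p * a)%:E <= \int[lebn]_h F h x)%E.
  move=> Bx; pose A' := (translate (tnth x) @^-1` A).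
  have mA' : measurable A'.
    by rewrite -[X in measurable X]setTI; apply: measurable_translate_Rn.
  have A'a : (lebn A' <= a%:E)%E.
    rewrite -[X in lebn X]setIT -integral_indic//.
    have -> : (\int[lebn]_h (\1_A' h)%:E = lebn A)%E.
      rewrite -[A in RHS]setIT -integral_indic//.
      rewrite -(@ge0_integral_translate_Rn _ _ (tnth x) (fun h => (\1_A h)%:E))//.
      by apply/measurable_EFinP; exact: measurable_indic.
    exact: Aa.
  have Q'a : (a%:E <= lebn (Q `\` A'))%E.
    rewrite -(@leeD2rE _ a%:E)// -EFinD -mulr2n -mulr_natl -Qa.
    rewrite [leLHS](measureDI lebn mQ mA') leeD2l//.
    by apply: le_trans A'a; apply: measureIr.
  have mQ' : measurable (Q `\` A') by exact: measurableD.
  apply: (@le_trans _ _ (\int[lebn]_h ((M `^ p)%:E * (\1_(Q `\` A') h)%:E))%E).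
    rewrite integral_cst_indic ?powR_ge0// EFinM.
    by apply: lee_wpmul2l => //; rewrite lee_fin powR_ge0.
  apply: ge0_le_integral => //.
  - by move=> h _; rewrite mule_ge0 ?lee_fin ?powR_ge0.
  - by apply: measurable_funeM; apply/measurable_EFinP; exact: measurable_indic.
  - exact: (measurableT_comp mF (pair2_measurable x)).
  move=> h _; rewrite indicE.
  have [/[!inE] -[Qh A'h]|_] := boolP (h \in _); last by rewrite mule0 F0.
  have xh : translate (tnth h) x = translate (tnth x) h.
    by apply: eq_from_tnth => i; rewrite !tnth_mktuple addrC.
  by rewrite /F (wB x Bx) indicE mem_set// xh (wA _ A'h) sub0r normrN ger0_norm.
apply: (@le_trans _ _ (\int[lebn]_x ((M `^ p * a)%:E * (\1_B x)%:E))%E).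
  by rewrite integral_cst_indic ?mulr_ge0 ?powR_ge0.
apply: ge0_le_integral => //.
- by move=> x _; rewrite mule_ge0// lee_fin mulr_ge0// powR_ge0.
- by apply: measurable_funeM; apply/measurable_EFinP; exact: measurable_indic.
- exact: (measurable_integral lebn mF').
move=> x _; rewrite indicE; have [/[!inE] Bx|_] := boolP (x \in _).
  by rewrite mule1 FB.
by rewrite mule0; apply: integral_ge0 => h _.
Qed.

End box_averages.

(** * The level set inequality *)

Section level_sets.
Context {R : realType} {n : nat}.
Local Notation leb := (@lebesgue_measure R).
Local Notation mR := (measurableTypeR R).
Local Notation lebn := (@lebesgue_Rn R n).
Variables (p s0 : R) (s : 'I_n -> R) (w : Rn R n -> R).
Hypothesis n_gt0 : (0 < n)%N.
Hypothesis p1 : 1 <= p.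
Hypothesis s0_gt0 : 0 < s0.
Hypothesis s_itv : forall k, s0 <= s k < 1.
Hypothesis mw : measurable_fun setT w.

Let p0 : 0 < p := lt_le_trans ltr01 p1.

Let s_gt0 k : 0 < s k.
Proof. by have /andP[/(lt_le_trans s0_gt0)] := s_itv k. Qed.

Let s_lt1 k : s k < 1.
Proof. by have /andP[] := s_itv k. Qed.

Lemma sum_inv_gt0 : 0 < \sum_(k < n) (s k)^-1.
Proof.
rewrite (bigD1 (Ordinal n_gt0))//= ltr_pwDl ?invr_gt0// sumr_ge0// => k _.
by rewrite invr_ge0 ltW.
Qed.

Lemma hmeanE : hmean s = n%:R / \sum_(k < n) (s k)^-1.
Proof. by rewrite /hmean invfM invrK. Qed.

Lemma prod_powR (r : R) (e : 'I_n -> R) : 0 < r ->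
  \prod_(k < n) r `^ e k = r `^ (\sum_(k < n) e k).
Proof.
move=> r0; elim: (index_enum _) => [|k t ih].
  by rewrite !big_nil powRr0.
by rewrite !big_cons ih powRD // (gt_eqF r0) implybT.
Qed.

Lemma measurable_box (I : 'I_n -> set mR) : (forall i, measurable (I i)) ->
  measurable [set h : Rn R n | forall i, I i (tnth h i)].
Proof.
move=> mI; rewrite [X in measurable X](_ : _ = \bigcap_(i in [set: 'I_n])
    (tnth (T := mR) ^~ i @^-1` I i)).
  apply: fin_bigcap_measurable => // i _.
  by rewrite -[X in measurable X]setTI; exact: measurable_tnth.
by apply/seteqP; split=> x /= h i; [move=> _ |]; exact: h.
Qed.

(** [integral_dyadic_le] supplies the factor $p(1 - s_k)$, and $1 \le s_k / s_0$ completes it to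
    $s_k(1 - s_k)$. Extending the integral from $]0, \rho]$ to the line only increases it. *)
Lemma axis_osc_le_energy k (rho : R) : 0 < rho ->
  (\int[leb]_(h in `](rho / 2)%R, rho]) axis_osc p w k h <=
   (rho `^ (1 + s k * p) * (p / s0))%:E *
   ((s k * (1 - s k))%:E *
    \int[leb]_h (axis_osc p w k h * (`|h| `^ (-1 - s k * p))%:E)))%E.
Proof.
move=> rho0.
have mosc := measurable_axis_osc p mw k.
have mW : measurable_fun setT (fun h : mR =>
    (axis_osc p w k h * (`|h| `^ (-1 - s k * p))%:E)%E).
  apply: emeasurable_funM => //; apply/measurable_EFinP.
  by apply: (measurableT_comp (measurable_powR _)); exact: normr_measurable.
have W0 (h : mR) : (0 <= axis_osc p w k h * (`|h| `^ (-1 - s k * p))%:E)%E.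
  by rewrite mule_ge0 ?axis_osc_ge0// lee_fin powR_ge0.
have sk : 0 < s k < 1 by rewrite s_gt0 s_lt1.
apply: (le_trans (integral_dyadic_le p0 sk rho0 mosc (axis_osc_ge0 p w k)
  (fun h => axis_osc_double mw k h p1))).
set J := (\int[leb]_h _)%E.
have JJ : (\int[leb]_(h in `]0%R, rho])
    (axis_osc p w k h * (h `^ (-1 - s k * p))%:E) <= J)%E.
  rewrite (eq_integral (fun h : mR => axis_osc p w k h * (`|h| `^ (-1 - s k * p))%:E)%E).
    apply: ge0_subset_integral => //.
  move=> h; rewrite inE/= in_itv/= => /andP[h0 _].
  by rewrite ger0_norm// ltW.
have J0 : (0 <= J)%E by apply: integral_ge0 => h _; exact: W0.
apply: (@le_trans _ _ ((rho `^ (1 + s k * p) * (p * (1 - s k)))%:E * J)%E).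
  apply: lee_wpmul2l => //.
  by rewrite lee_fin !mulr_ge0 ?powR_ge0 ?(ltW p0)// subr_ge0 ltW.
rewrite muleA -EFinM; apply: lee_wpmul2r => //.
rewrite lee_fin -!mulrA ler_wpM2l ?powR_ge0// ler_wpM2l ?(ltW p0)//.
rewrite mulrA ler_peMl ?subr_ge0 ?(ltW (s_lt1 k))//.
by rewrite mulrC ler_pdivlMr// mul1r; have /andP[] := s_itv k.
Qed.

Lemma level_energy_le (A B : set (Rn R n)) (M a : R) :
  measurable A -> measurable B -> (lebn A <= a%:E)%E -> 0 < a -> 0 <= M ->
  (forall x, ~ A x -> w x = 0) -> (forall x, B x -> w x = M) ->
  ((M `^ p)%:E * lebn B <=
   (4 * n%:R `^ p * (p / s0) * (2 ^+ n.+1 * a) `^ (p * hmean s / n%:R))%:E *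
   \int[lebn]_x \int[mu_axes s p x]_y (`|w x - w y| `^ p)%:E)%E.
Proof.
move=> mA mB Aa a0 M0 wA wB.
pose H := \sum_(k < n) (s k)^-1.
have H0 : 0 < H := sum_inv_gt0.
have a20 : 0 < 2 ^+ n.+1 * a :> R by rewrite mulr_gt0// exprn_gt0.
(* The product of the sides $\rho_k/2$ is $r^H / 2^n$; this choice of [r] makes it $2a$. *)
have [r r0 rE] : exists2 r, 0 < r & r = (2 ^+ n.+1 * a) `^ H^-1.
  by exists ((2 ^+ n.+1 * a) `^ H^-1); rewrite // powR_gt0.
pose rho k := r `^ (s k)^-1.
have rho0 k : 0 < rho k by rewrite powR_gt0.
(* The exponent $1/s_k$ in [rho] is there to make $\rho_k^{s_k p} = r^p$ the same on every axis. *)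
have rhop k : rho k `^ (1 + s k * p) = rho k * r `^ p.
  rewrite powRD; last by rewrite (gt_eqF (rho0 k)) implybT.
  have -> : rho k `^ 1 = rho k by apply: powRr1; exact: ltW.
  have -> // : rho k `^ (s k * p) = r `^ p.
  by rewrite /rho -powRrM mulrA mulVf ?mul1r// lt0r_neq0.
have -> : (2 ^+ n.+1 * a) `^ (p * hmean s / n%:R) = r `^ p.
  rewrite rE -powRrM; congr (_ `^ _).
  have nN0 : n%:R != 0 :> R by rewrite pnatr_eq0 -lt0n.
  by rewrite hmeanE -/H; field; rewrite gt_eqF.
pose I k : set mR := `]rho k / 2, rho k]%classic.
have mI k : measurable (I k) by exact: measurable_itv.
have lebI k : leb (I k) = (rho k / 2)%:E.
  rewrite lebesgue_measure_itv/= lte_fin ifT; last by have := rho0 k; lra.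
  by rewrite -EFinB; congr EFin; lra.
have prodrho : \prod_(k < n) (rho k / 2) = 2 * a.
  rewrite big_split/= prodr_const card_ord prod_powR// -/H.
  rewrite rE -powRrM mulVf ?gt_eqF// powRr1 ?(ltW a20)//.
  rewrite exprS exprVn; field.
  by rewrite expf_neq0.
pose Q := [set h : Rn R n | forall i, I i (tnth h i)].
have Qa : lebn Q = (2 * a)%:E.
  rewrite lebesgue_Rn_box//; under eq_bigr do rewrite lebI.
  by rewrite prodEFin prodrho.
have mQ : measurable Q by exact: measurable_box.
have s01 k : 0 <= s k <= 1 by rewrite !ltW.
rewrite (energy_mu_axes _ s01 mw).
rewrite -(@lee_pmul2l _ a%:E)// ?lte_fin//.
apply: (@le_trans _ _ ((M `^ p * a)%:E * lebn B)%E).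
  by rewrite muleA -EFinM (mulrC a).
apply: (le_trans (integral_box_dist_ge p mw mQ mA mB Qa Aa (ltW a0) M0 wA wB)).
have mosc k : measurable_fun setT (fun h : Rn R n => axis_osc p w k (tnth h k)).
  exact: (measurableT_comp (measurable_axis_osc p mw k) (measurable_tnth k)).
have mS : measurable_fun setT (fun h : Rn R n => \sum_(k < n) axis_osc p w k (tnth h k))%E.
  by apply: emeasurable_sum.
have S0 (h : Rn R n) : (0 <= \sum_(k < n) axis_osc p w k (tnth h k))%E.
  by apply: sume_ge0 => k _; exact: axis_osc_ge0.
apply: (@le_trans _ _ (\int[lebn]_(h in Q)
   ((n%:R `^ p)%:E * \sum_(k < n) axis_osc p w k (tnth h k)))%E).
  apply: ge0_le_integral => //.
  - by move=> h _; apply: integral_ge0 => x _; rewrite lee_fin powR_ge0.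
  - apply: measurable_funTS; apply: (measurable_integral lebn
      (F := fun h x => (`|w (translate (tnth h) x) - w x| `^ p)%:E)).
      exact: measurable_dist_translate.
    by move=> *; rewrite lee_fin powR_ge0.
  - by apply: measurable_funTS; exact: measurable_funeM.
  - by move=> h _; exact: integral_translate_le_axis_osc.
rewrite ge0_integralZl; [|exact: mQ|exact: measurable_funTS|by move=> h _|
  by rewrite lee_fin powR_ge0].
rewrite ge0_integral_sum; [|exact: mQ|by move=> k; exact: measurable_funTS|
  by move=> k h _; exact: axis_osc_ge0].
pose T k := ((s k * (1 - s k))%:E *
    \int[leb]_h (axis_osc p w k h * (`|h| `^ (-1 - s k * p))%:E))%E.
have T0 k : (0 <= T k)%E.
  apply: mule_ge0; first by rewrite lee_fin mulr_ge0// ?subr_ge0 ltW.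
  by apply: integral_ge0 => h _; rewrite mule_ge0 ?axis_osc_ge0// lee_fin powR_ge0.
(* The sides other than the [k]-th have product $2a / (\rho_k/2) = 4a/\rho_k$, and this $\rho_k$
   cancels the one in $\rho_k^{1 + s_k p}$. *)
have termk k : (\int[lebn]_(h in Q) axis_osc p w k (tnth h k) <=
    (4 * a * r `^ p * (p / s0))%:E * T k)%E.
  rewrite (integral_box_coord k mI (measurable_axis_osc p mw k) (axis_osc_ge0 p w k)).
  have -> : (\prod_(i < n | i != k) leb (I i) = (4 * a / rho k)%:E)%E.
    under eq_bigr do rewrite lebI.
    rewrite prodEFin; congr EFin.
    move: prodrho; rewrite (bigD1 k)//=; set P := \prod_(i < n | _) _ => PE.
    have rhoN0 : rho k != 0 by rewrite gt_eqF.
    have -> : 4 * a = rho k * P by lra.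
    by rewrite mulrAC divff// mul1r.
  apply: (@le_trans _ _ ((4 * a / rho k)%:E *
      ((rho k `^ (1 + s k * p) * (p / s0))%:E * T k))%E).
    apply: lee_wpmul2l; first by rewrite lee_fin divr_ge0 ?mulr_ge0// ltW.
    exact: axis_osc_le_energy.
  rewrite muleA -EFinM rhop; apply: lee_wpmul2r => //.
  rewrite lee_fin le_eqVlt; apply/orP; left; apply/eqP.
  by field; rewrite !gt_eqF.
apply: (@le_trans _ _ ((n%:R `^ p)%:E *
    \sum_(k < n) ((4 * a * r `^ p * (p / s0))%:E * T k))%E).
  by apply: lee_wpmul2l; [rewrite lee_fin powR_ge0|apply: lee_sum].
rewrite -ge0_sume_distrr// !muleA -!EFinM le_eqVlt; apply/orP; left; apply/eqP.
by congr (_%:E * _)%E; ring.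
Qed.

End level_sets.

(** * Truncations *)

Section truncation.
Context {R : realType}.
Implicit Types a b c p t x y : R.

Definition truncate t x := Num.min (Num.max (`|x| - t) 0) t.

Lemma truncate_eq0 t x : 0 <= t -> `|x| <= t -> truncate t x = 0.
Proof.
by move=> t0 xt; rewrite /truncate max_r ?min_l// subr_le0.
Qed.

Lemma truncate_eq t x : 0 <= t -> 2 * t < `|x| -> truncate t x = t.
Proof.
move=> t0 xt; rewrite /truncate max_l ?min_r//; lra.
Qed.

Lemma measurable_truncate t : measurable_fun setT (truncate t).
Proof.
apply: measurable_minr => //; apply: measurable_maxr => //.
by apply: measurable_funB => //; exact: normr_measurable.
Qed.

Lemma clamp_dist_le a b c d : c <= d ->
  `|Num.min (Num.max a c) d - Num.min (Num.max b c) d| <= `|a - b|.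
Proof.
move=> cd; wlog ab : a b / a <= b => [h|].
  have [ab|/ltW ba] := leP a b; first exact: h.
  by rewrite distrC (distrC a); exact: h.
have m1 : Num.min (Num.max a c) d <= Num.min (Num.max b c) d by rewrite le_min2// le_max2.
rewrite !ler0_norm ?subr_le0// !opprB.
by have [?|?] := leP a c; have [?|?] := leP b c; rewrite !minEle;
  do ![case: ifPn; rewrite -?ltNge => ?]; lra.
Qed.

(* Clamping to [c, d] and truncating between d and 2d add up to clamping to
   [c, 2d], and all three maps are monotone. *)
Lemma clamp_truncate_le a b c d : 0 <= d -> c <= d ->
  `|Num.min (Num.max a c) d - Num.min (Num.max b c) d| +
  `|Num.min (Num.max (a - d) 0) d - Num.min (Num.max (b - d) 0) d| <=
  `|Num.min (Num.max a c) (2 * d) - Num.min (Num.max b c) (2 * d)|.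
Proof.
move=> d0 cd; wlog ab : a b / a <= b => [h|].
  have [ab|/ltW ba] := leP a b; first exact: h.
  have := h b a ba; rewrite (distrC (Num.min (Num.max b c) d)).
  by rewrite (distrC (Num.min (Num.max (b - d) 0) d)) (distrC (Num.min (Num.max b c) (2 * d))).
have cE x : Num.min (Num.max x c) (2 * d) =
    Num.min (Num.max x c) d + Num.min (Num.max (x - d) 0) d.
  have [xd|dx] := leP x d.
    have -> : Num.min (Num.max (x - d) 0) d = 0 by rewrite max_r ?min_l// subr_le0.
    rewrite addr0.
    have md : Num.max x c <= d by rewrite ge_max xd.
    by rewrite !min_l//; lra.
  rewrite !(@max_l _ _ x) ?(@max_l _ _ (x - d)) ?subr_ge0 ?(ltW dx)//; last by lra.
  rewrite (min_r (ltW dx)).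
  by have [?|?] := leP x (2 * d); have [?|?] := leP (x - d) d; lra.
have m1 : Num.min (Num.max a c) d <= Num.min (Num.max b c) d by rewrite le_min2// le_max2.
have m2 : Num.min (Num.max (a - d) 0) d <= Num.min (Num.max (b - d) 0) d.
  by rewrite le_min2// le_max2// lerB.
rewrite !cE !ler0_norm; lra.
Qed.

(** Write $z^p = z \cdot z^{p-1}$ and use that $z^{p-1}$ is nondecreasing. *)
Lemma powR_superadditive p x y : 1 <= p -> 0 <= x -> 0 <= y ->
  x `^ p + y `^ p <= (x + y) `^ p.
Proof.
move=> p1 x0 y0.
have [->|xN0] := eqVneq x 0; first by rewrite powR0 ?add0r// gt_eqF// (lt_le_trans ltr01).
have [->|yN0] := eqVneq y 0; first by rewrite powR0 ?addr0// gt_eqF// (lt_le_trans ltr01).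
have e z : z != 0 -> 0 <= z -> z `^ p = z * z `^ (p - 1).
  move=> zN0 z0; rewrite -{2}(powRr1 z0) -powRD ?zN0 ?implybT//.
  by congr (_ `^ _); ring.
have xy0 : x + y != 0 by rewrite gt_eqF// addr_gt0 ?lt0r ?xN0 ?yN0.
have pm1 : 0 <= p - 1 by rewrite subr_ge0.
rewrite !e ?addr_ge0// mulrDl lerD// ler_wpM2l// ge0_ler_powR// ?nnegrE ?addr_ge0//.
  by rewrite lerDl.
by rewrite lerDr.
Qed.

(** The induction carries a sharper bound, by the increment of $|\cdot|$ clamped to $[c, c2^m]$. The
    truncation at level $c2^m$ extends the clamp to $[c, c2^{m+1}]$ by [clamp_truncate_le], and
    superadditivity merges the two powers. Clamping is 1-Lipschitz. *)
Lemma sum_truncate_powR_le p c (m : nat) x y : 1 <= p -> 0 < c ->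
  \sum_(i < m) `|truncate (c * 2 ^+ i) x - truncate (c * 2 ^+ i) y| `^ p <=
  `|x - y| `^ p.
Proof.
move=> p1 c0; have p0 : 0 <= p by apply: le_trans p1.
pose G j (z : R) := Num.min (Num.max `|z| c) (c * 2 ^+ j).
have cm j : c <= c * 2 ^+ j by rewrite ler_peMr ?(ltW c0)// exprn_ege1// ler1n.
suff h : \sum_(i < m) `|truncate (c * 2 ^+ i) x - truncate (c * 2 ^+ i) y| `^ p
    <= `|G m x - G m y| `^ p.
  apply: (le_trans h).
  rewrite ge0_ler_powR// ?nnegrE//.
  apply: (@le_trans _ _ `| `|x| - `|y| |); last exact: ler_dist_dist.
  exact: clamp_dist_le.
elim: m => [|m ih]; first by rewrite big_ord0 powR_ge0.
rewrite big_ord_recr/=.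
apply: (le_trans (lerD ih (lexx _))).
apply: (le_trans (powR_superadditive p1 (normr_ge0 _) (normr_ge0 _))).
rewrite ge0_ler_powR// ?nnegrE ?addr_ge0//.
rewrite /G /truncate exprS mulrCA; apply: clamp_truncate_le => //.
exact: le_trans (ltW c0) (cm m).
Qed.

End truncation.

(** * Summation of the recursion over dyadic levels *)

Section level_sequence.
Context {R : realType}.

(* With b_i = (c 2^i)^q a_i the recursion reads b_(i+1) <= 2^q K b_i^(1 - p/q) e_i,
   so S <= b_0 + 2^q K E S^(1 - p/q) for the sum S; either the second term is at
   most S / 2, or S^(p/q) <= 2 (2^q K E). *)
Lemma level_sum_le (p q c K E : R) (a e : nat -> R) (m : nat) :
  0 < p < q -> 0 < c -> 0 <= K -> 0 <= E ->
  (forall i, 0 <= a i) -> (forall i, 0 <= e i) ->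
  \sum_(i < m) e i <= E ->
  (forall i, (c * 2 ^+ i) `^ p * a i.+1 <= K * a i `^ (1 - p / q) * e i) ->
  \sum_(i < m) (c * 2 ^+ i) `^ q * a i <=
    (2 * (2 `^ q * K * E)) `^ (q / p) + 2 * (c `^ q * a 0%N).
Proof.
move=> /andP[p0 pq] c0 K0 E0 a0 e0 eE step.
have q0 : 0 < q by exact: lt_trans pq.
pose t i := c * 2 ^+ i.
have t0 i : 0 < t i by rewrite mulr_gt0// exprn_gt0.
pose b i := t i `^ q * a i.
have b0 i : 0 <= b i by rewrite mulr_ge0// powR_ge0.
pose S := \sum_(i < m) b i.
have S0 : 0 <= S by exact: sumr_ge0.
have th0 : 0 < 1 - p / q by rewrite subr_gt0 ltr_pdivrMr// mul1r.
set L := 2 `^ q * K.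
have L0 : 0 <= L by rewrite mulr_ge0// powR_ge0.
(* One has $t_{i+1}^q = 2^q t_i^{q-p} t_i^p$, and $t_i^{q-p} = (t_i^q)^{1-p/q}$ is absorbed into
   $b_i^{1-p/q}$. *)
have bS i : b i.+1 <= L * b i `^ (1 - p / q) * e i.
  have -> : b i.+1 = 2 `^ q * t i `^ (q - p) * (t i `^ p * a i.+1).
    have tS : t i.+1 = 2 * t i by rewrite /t exprS mulrCA.
    have tq : t i `^ q = t i `^ (q - p) * t i `^ p.
      by rewrite -powRD ?subrK// (gt_eqF (t0 i)) implybT.
    rewrite /b tS powRM//; last exact: ltW.
    by rewrite tq !mulrA.
  have -> : b i `^ (1 - p / q) = t i `^ (q - p) * a i `^ (1 - p / q).
    rewrite /b powRM ?powR_ge0// -powRrM; congr (_ `^ _ * _).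
    by field; rewrite gt_eqF.
  have := step i; rewrite -/(t i) => stepi.
  rewrite /L [leRHS](_ : _ = 2 `^ q * t i `^ (q - p) *
    (K * a i `^ (1 - p / q) * e i)); last by ring.
  by rewrite ler_wpM2l// mulr_ge0// powR_ge0.
(* The recursion bounds every term but the first; $b_i \le S$ for $i < m$ lets the common factor
   $S^{1-p/q}$ leave the sum. *)
have Sle : S <= b 0%N + L * E * S `^ (1 - p / q).
  case: m eE @S S0 => [|m] eE S S0.
    by rewrite {1}/S big_ord0 addr_ge0// mulr_ge0 ?powR_ge0// mulr_ge0.
  rewrite {1}/S big_ord_recl/= lerD2l.
  apply: (@le_trans _ _ (\sum_(i < m) L * S `^ (1 - p / q) * e i)).
    apply: ler_sum => i _; rewrite /bump/= add1n (le_trans (bS _))//.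
    rewrite ler_wpM2r// ler_wpM2l// ge0_ler_powR ?nnegrE ?(ltW th0)//.
    have im : (i < m.+1)%N by rewrite ltnS ltnW.
    by rewrite /S (bigD1 (Ordinal im))//= lerDl sumr_ge0.
  rewrite -mulr_sumr mulrAC ler_wpM2r ?powR_ge0// ler_wpM2l//.
  by apply: le_trans eE; rewrite big_ord_recr/= lerDl.
have b0E : c `^ q * a 0%N = b 0%N by rewrite /b /t expr0 mulr1.
rewrite -/S b0E.
have [h|h] := leP (S `^ (p / q)) (2 * (L * E)).
  apply: (@le_trans _ _ ((2 * (L * E)) `^ (q / p))).
    have {1}-> : S = (S `^ (p / q)) `^ (q / p).
      rewrite -powRrM (_ : p / q * (q / p) = 1) ?powRr1//.
      by field; rewrite !gt_eqF.
    by rewrite ge0_ler_powR ?nnegrE ?powR_ge0 ?mulr_ge0 ?invr_ge0 ?(ltW p0) ?(ltW q0).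
  by rewrite lerDl mulr_ge0.
have SN0 : S != 0.
  apply: contraTneq h => ->; rewrite powR0 ?gt_eqF ?divr_gt0// -leNgt.
  by rewrite !mulr_ge0.
have : S = S `^ (p / q) * S `^ (1 - p / q).
  rewrite -powRD ?SN0 ?implybT// (_ : p / q + (1 - p / q) = 1) ?powRr1//; ring.
have := powR_ge0 S (1 - p / q); have := powR_ge0 (2 * (L * E)) (q / p).
move: Sle h; set X := S `^ (1 - _); set Y := S `^ _; set Z := _ `^ (q / p).
move=> Sle h Z0 X0 SE.
have : 2 * (L * E) * X <= Y * X by rewrite ler_wpM2r// ltW.
rewrite -SE; lra.
Qed.

End level_sequence.

(** * Integrals over level sets *)

Section superlevel_integrals.
Context d (T : measurableType d) {R : realType}.
Variables (mu : {measure set T -> \bar R}) (u : T -> R).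
Hypothesis meas_u : measurable_fun setT u.
Local Open Scope ereal_scope.

Lemma measurable_superlevel (c : R) : measurable [set x | (c < `|u x|)%R].
Proof.
have mu' : measurable_fun setT (fun x => `|u x|%R) by exact: measurableT_comp.
rewrite -[X in measurable X]setTI.
rewrite (_ : [set x | _] = (fun x => `|u x|%R) @^-1` `]c, +oo[).
  by apply: mu' => //; exact: measurable_itv.
by apply/seteqP; split => x /=; rewrite in_itv/= andbT.
Qed.

Lemma measurable_sublevel (c : R) : measurable [set x | (`|u x| <= c)%R].
Proof.
rewrite (_ : [set x | _] = ~` [set x | (c < `|u x|)%R]).
  exact/measurableC/measurable_superlevel.
by apply/seteqP; split => x /=; rewrite leNgt => /negP.
Qed.

Lemma measurable_powR_norm (q : R) D : measurable_fun D (fun x => (`|u x| `^ q)%:E).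
Proof.
apply: measurable_funTS; apply/measurable_EFinP.
by apply: (measurableT_comp (measurable_powR _)); exact: measurableT_comp.
Qed.

(** Chebyshev's inequality. *)
Lemma superlevel_measure_le (p c : R) : (0 < p)%R -> (0 < c)%R ->
  (c `^ p)%:E * mu [set x | (c < `|u x|)%R] <= \int[mu]_x (`|u x| `^ p)%:E.
Proof.
move=> p0 c0; rewrite -integral_cst_indic ?powR_ge0//; last exact: measurable_superlevel.
apply: ge0_le_integral => //.
- by move=> x _; rewrite mule_ge0 ?lee_fin ?powR_ge0.
- apply: measurable_funeM; apply/measurable_EFinP; apply: measurable_indic.
  exact: measurable_superlevel.
- exact: measurable_powR_norm.
move=> x _; rewrite indicE; have [/[!inE]/= cx|_] := boolP (x \in _).
  by rewrite mule1 lee_fin ge0_ler_powR ?nnegrE// ltW.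
by rewrite mule0 lee_fin powR_ge0.
Qed.

(** On the sublevel set $|u|^q = |u|^{q-p} |u|^p \le c^{q-p} |u|^p$. *)
Lemma sublevel_integral_le (p q c : R) : (0 < p <= q)%R -> (0 < c)%R ->
  \int[mu]_(x in [set x | (`|u x| <= c)%R]) (`|u x| `^ q)%:E <=
  (c `^ (q - p))%:E * \int[mu]_x (`|u x| `^ p)%:E.
Proof.
move=> /andP[p0 pq] c0.
rewrite -ge0_integralZl; [|exact: measurableT|exact: measurable_powR_norm|
  by move=> x _; rewrite lee_fin powR_ge0|by rewrite lee_fin powR_ge0].
apply: (@le_trans _ _ (\int[mu]_(x in [set x | (`|u x| <= c)%R])
    ((c `^ (q - p))%:E * (`|u x| `^ p)%:E))).
  apply: ge0_le_integral.
  - exact: measurable_sublevel.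
  - by move=> x _; rewrite lee_fin powR_ge0.
  - exact: measurable_powR_norm.
  - by apply: measurable_funeM; exact: measurable_powR_norm.
  move=> x /= xc; rewrite -EFinM lee_fin.
  have [->|uN0] := eqVneq `|u x|%R 0%R.
    by rewrite !powR0 ?mulr0 ?gt_eqF// (lt_le_trans p0).
  have -> : (`|u x| `^ q = `|u x| `^ (q - p) * `|u x| `^ p)%R.
    by rewrite -powRD ?subrK// uN0 implybT.
  rewrite ler_wpM2r ?powR_ge0// ge0_ler_powR ?nnegrE ?(ltW c0)// subr_ge0//.
apply: ge0_subset_integral => //; first exact: measurable_sublevel.
- by apply: measurable_funeM; exact: measurable_powR_norm.
- by move=> x _; rewrite mule_ge0 ?lee_fin ?powR_ge0.
Qed.

Definition layer (c : R) (m : nat) : set T := [set x | (c < `|u x| <= c * 2 ^+ m)%R].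

Lemma measurable_layer c m : measurable (layer c m).
Proof.
rewrite (_ : layer c m = [set x | (c < `|u x|)%R] `&` [set x | (`|u x| <= c * 2 ^+ m)%R]).
  by apply: measurableI; [exact: measurable_superlevel|exact: measurable_sublevel].
by apply/seteqP; split => x /=; [move/andP|move=> cx; apply/andP].
Qed.

(** Each induction step adds the set where $c2^m < |u| \le c2^{m+1}$, on which $|u|^q$ is at most
    the [q]-th power of the upper end. *)
Lemma layer_integral_le (q c : R) (m : nat) : (0 < q)%R -> (0 < c)%R ->
  \int[mu]_(x in layer c m) (`|u x| `^ q)%:E <=
  \sum_(i < m) ((2 * (c * 2 ^+ i)) `^ q)%:E * mu [set x | (c * 2 ^+ i < `|u x|)%R].
Proof.
move=> q0 c0; elim: m => [|m ih].
  rewrite big_ord0 (_ : layer c 0 = set0) ?integral_set0//.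
  apply/seteqP; split => x //=; rewrite /layer/= expr0 mulr1.
  by move=> /andP[/lt_le_trans h /h]; rewrite ltxx.
pose D := [set x | (c * 2 ^+ m < `|u x|)%R] `&` [set x | (`|u x| <= c * 2 ^+ m.+1)%R].
have mD : measurable D.
  by apply: measurableI; [exact: measurable_superlevel|exact: measurable_sublevel].
have cm : (c <= c * 2 ^+ m)%R by rewrite ler_peMr ?(ltW c0)// exprn_ege1// ler1n.
have -> : layer c m.+1 = layer c m `|` D.
  apply/seteqP; split => x /=; rewrite /layer/D/=.
    move=> /andP[cx xm]; have [h|h] := leP `|u x|%R (c * 2 ^+ m)%R; last by right.
    by left; rewrite cx.
  move=> [/andP[-> h]/=|[h ->]]; last by rewrite (le_lt_trans cm h).
  by rewrite (le_trans h)// ler_pM2l// ler_eXn2l// ltr1n.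
rewrite ge0_integral_setU//=; last 3 first.
- exact: measurable_layer.
- exact: measurable_powR_norm.
- apply/disj_setPS => x [] /andP[_ /= h] [/= h' _].
  by move: h; rewrite leNgt h'.
rewrite big_ord_recr/=; apply: leeD => //.
rewrite -integral_cst_indic ?powR_ge0//; last exact: measurable_superlevel.
rewrite integral_mkcond; apply: ge0_le_integral => //.
- by move=> x _; apply: erestrict_ge0 => y _; rewrite lee_fin powR_ge0.
- by apply/(measurable_restrictT _ mD); exact: measurable_powR_norm.
- apply: measurable_funeM; apply/measurable_EFinP; apply: measurable_indic.
  exact: measurable_superlevel.
move=> x _; rewrite patchE; case: ifPn => [/[!inE] -[/= h1 h2]|_].
  rewrite indicE mem_set// mule1 lee_fin ge0_ler_powR ?nnegrE ?(ltW q0)//.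
    by rewrite !mulr_ge0// ltW.
  by rewrite mulrCA -exprS.
by rewrite mule_ge0 ?lee_fin ?powR_ge0.
Qed.

(** The layers increase to the superlevel set, so the uniform bound survives the limit by monotone
    convergence. *)
Lemma superlevel_integral_le (q c : R) (B : \bar R) : (0 < q)%R -> (0 < c)%R ->
  (forall m, \sum_(i < m) ((2 * (c * 2 ^+ i)) `^ q)%:E *
     mu [set x | (c * 2 ^+ i < `|u x|)%R] <= B) ->
  \int[mu]_(x in [set x | (c < `|u x|)%R]) (`|u x| `^ q)%:E <= B.
Proof.
move=> q0 c0 hB.
have -> : [set x | (c < `|u x|)%R] = \bigcup_m layer c m.
  apply/seteqP; split => [x /= cx|x [m _ /= /andP[]]//].
  have [m hm] : exists m, (`|u x| / c < 2 ^+ m)%R.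
    exists (Num.truncn (`|u x| / c)).+1.
    apply: (@lt_le_trans _ _ (Num.truncn (`|u x| / c)).+1%:R).
      by apply: truncnS_gt.
    by rewrite -natrX ler_nat ltnW// ltn_expl.
  exists m => //; rewrite /layer/= cx/= mulrC -ler_pdivrMr// ltW//.
have h : \int[mu]_(x in layer c m) (`|u x| `^ q)%:E @[m --> \oo] -->
    \int[mu]_(x in \bigcup_m layer c m) (`|u x| `^ q)%:E.
  apply: ge0_nondecreasing_set_cvg_integral.
  - move=> i j ij; apply/subsetPset => x /=; rewrite /layer/= => /andP[-> h]/=.
    by rewrite (le_trans h)// ler_pM2l// ler_weXn2l// ler1n.
  - exact: measurable_layer.
  - by move=> i; exact: measurable_powR_norm.
  - by move=> i x _; rewrite lee_fin powR_ge0.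
rewrite -(cvg_lim _ h)//; apply: lime_le; first by apply/cvg_ex; eexists; exact: h.
by apply: nearW => m; apply: le_trans (hB m); exact: layer_integral_le.
Qed.

End superlevel_integrals.

(** * The inequality for Borel functions *)

Section sobolev_borel.
Context {R : realType} {n : nat}.
Local Notation leb := (@lebesgue_measure R).
Local Notation mR := (measurableTypeR R).
Local Notation lebn := (@lebesgue_Rn R n).
Variables (p q s0 : R) (s : 'I_n -> R) (u : Rn R n -> R).
Hypothesis n_gt0 : (0 < n)%N.
Hypothesis p1 : 1 < p.
Hypothesis s0_gt0 : 0 < s0.
Hypothesis s_itv : forall k, s0 <= s k < 1.
Hypothesis meas_u : measurable_fun setT u.

Let energy (v : Rn R n -> R) := (\int[lebn]_x \int[mu_axes s p x]_y (`|v x - v y| `^ p)%:E)%E.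

Let p0 : 0 < p := lt_trans ltr01 p1.

Let s01 k : 0 <= s k <= 1.
Proof.
by have /andP[h1 h2] := s_itv k; rewrite (ltW h2) (le_trans (ltW s0_gt0) h1).
Qed.

Let energy_ge0 v : (0 <= energy v)%E.
Proof.
apply: integral_ge0 => x _; apply: integral_ge0 => [|y _]; first exact: s01.
by rewrite lee_fin powR_ge0.
Qed.

Lemma measurable_truncate_comp t : measurable_fun setT (truncate t \o u).
Proof. exact: (measurableT_comp (measurable_truncate t) meas_u). Qed.

Lemma sum_axis_osc_truncate_le c m k (h : mR) : 0 < c ->
  (\sum_(i < m) axis_osc p (truncate (c * 2 ^+ i) \o u) k h <= axis_osc p u k h)%E.
Proof.
move=> c0; rewrite /axis_osc -ge0_integral_sum; last 3 first.
- exact: measurableT.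
- by move=> i; apply: measurable_axis_diff_shift; exact: measurable_truncate_comp.
- by move=> i x _; rewrite lee_fin powR_ge0.
apply: ge0_le_integral; [exact: measurableT|..].
- by move=> x _; apply: sume_ge0 => i _; rewrite lee_fin powR_ge0.
- apply: emeasurable_sum => i; apply: measurable_axis_diff_shift.
  exact: measurable_truncate_comp.
- exact: measurable_axis_diff_shift.
move=> x _; rewrite sumEFin lee_fin.
exact: sum_truncate_powR_le (ltW p1) c0.
Qed.

(** By [energy_mu_axes] all energies are integrals of axis increments against the same weights, so
    the pointwise bound [sum_truncate_powR_le] can be integrated in [x] and then in [h]. *)
Lemma sum_energy_truncate_le c m : 0 < c ->
  (\sum_(i < m) energy (truncate (c * 2 ^+ i) \o u) <= energy u)%E.
Proof.
move=> c0; rewrite /energy (energy_mu_axes _ s01 meas_u).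
under eq_bigr do rewrite (energy_mu_axes _ s01 (measurable_truncate_comp _)).
rewrite exchange_big/=; apply: lee_sum => k _.
have mw : measurable_fun setT (fun h : mR => (`|h| `^ (-1 - s k * p))%:E).
  apply/measurable_EFinP; apply: (measurableT_comp (measurable_powR _)).
  exact: normr_measurable.
have w0 (h : mR) : (0 <= (`|h| `^ (-1 - s k * p))%:E)%E by rewrite lee_fin powR_ge0.
have mt i := measurable_axis_osc p (measurable_truncate_comp (c * 2 ^+ i)) k.
rewrite -ge0_sume_distrr; last first.
  by move=> i _; apply: integral_ge0 => h _; rewrite mule_ge0// axis_osc_ge0.
apply: lee_wpmul2l.
  by have /andP[h1 h2] := s01 k; rewrite lee_fin mulr_ge0// subr_ge0.
rewrite -ge0_integral_sum; last 3 first.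
- exact: measurableT.
- by move=> i; apply: emeasurable_funM => //; exact: mt.
- by move=> i h _; rewrite mule_ge0// axis_osc_ge0.
apply: ge0_le_integral; [exact: measurableT|..].
- by move=> h _; apply: sume_ge0 => i _; rewrite mule_ge0// axis_osc_ge0.
- by apply: emeasurable_sum => i; apply: emeasurable_funM => //; exact: mt.
- by apply: emeasurable_funM => //; exact: measurable_axis_osc.
move=> h _; rewrite -ge0_sume_distrl; last by move=> i _; exact: axis_osc_ge0.
by apply: lee_wpmul2r => //; exact: sum_axis_osc_truncate_le.
Qed.

(** The constant of [level_energy_le] without its power of [a], the exponent $p \bar s / n$ being
    written as the equal $1 - p/q$ so that [s] does not occur. *)
Definition sobolev_const : R :=
  4 * n%:R `^ p * (p / s0) * (2 ^+ n.+1) `^ (1 - p / q).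

Lemma sobolev_const_gt0 : 0 < sobolev_const.
Proof. by rewrite !mulr_gt0 ?powR_gt0 ?invr_gt0 ?ltr0n ?exprn_gt0. Qed.

Hypothesis pq : p < q.
Hypothesis pqE : p * hmean s / n%:R = 1 - p / q.

Let q0 : 0 < q := lt_trans p0 pq.

Let K := sobolev_const.

(** [level_sum_le] for the measures of the level sets and the energies of the truncations. The bound
    [N] makes these measures finite and gives $c^q a_0 \le c^{q-p} N$; the outer $2^q$ comes from
    the upper ends $2t_i$ of the layers. *)
Lemma superlevel_sum_le (N E c : R) (m : nat) : 0 < c -> 0 <= E ->
  (\int[lebn]_x (`|u x| `^ p)%:E <= N%:E)%E -> (energy u <= E%:E)%E ->
  (\sum_(i < m) ((2 * (c * 2 ^+ i)) `^ q)%R%:E * lebn [set x | (c * 2 ^+ i < `|u x|)%R]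
    <= (2 `^ q * ((2 * (2 `^ q * K * E)) `^ (q / p) + 2 * (c `^ (q - p) * N)))%:E)%E.
Proof.
move=> c0 E0 uN uE.
pose t i := c * 2 ^+ i.
have t0 i : 0 < t i by rewrite mulr_gt0// exprn_gt0.
pose A i := [set x | t i < `|u x|].
have mA i : measurable (A i) := measurable_superlevel meas_u (t i).
have tA i : ((t i `^ p)%:E * lebn (A i) <= N%:E)%E.
  by apply: le_trans uN; exact: superlevel_measure_le.
have Afin i : lebn (A i) \is a fin_num.
  rewrite ge0_fin_numE// ltey; apply/eqP => Ay.
  by have := tA i; rewrite Ay gt0_muley ?lte_fin ?powR_gt0.
pose a i := fine (lebn (A i)).
have aE i : lebn (A i) = (a i)%:E by rewrite fineK.
have a0 i : 0 <= a i by exact: fine_ge0.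
pose w i := truncate (t i) \o u.
have mw i : measurable_fun setT (w i) := measurable_truncate_comp (t i).
have sumw j : (\sum_(i < j) energy (w i) <= E%:E)%E.
  by apply: le_trans uE; exact: sum_energy_truncate_le.
have wfin i : energy (w i) \is a fin_num.
  rewrite ge0_fin_numE//; apply: (le_lt_trans _ (ltry E)).
  apply: le_trans (sumw i.+1); rewrite big_ord_recr/= leeDr//.
  by apply: sume_ge0 => j _; exact: energy_ge0.
pose e i := fine (energy (w i)).
have eE i : energy (w i) = (e i)%:E by rewrite fineK.
have e0 i : 0 <= e i by exact: fine_ge0.
have step i : t i `^ p * a i.+1 <= K * a i `^ (1 - p / q) * e i.
  (* [level_energy_le] asks for a positive bound on the measure; if [a i] vanishes, so does
     [a i.+1], since the level sets decrease. *)
  have [ai0|ai0] := eqVneq (a i) 0.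
    have -> : a i.+1 = 0.
      apply/eqP; rewrite eq_le a0 andbT -ai0 -lee_fin -!aE le_measure ?inE//.
      move=> x; rewrite /A/=; apply: le_lt_trans.
      by rewrite /t ler_pM2l// ler_weXn2l// ler1n.
    rewrite mulr0; apply: mulr_ge0 (e0 i).
    exact: mulr_ge0 (ltW sobolev_const_gt0) (powR_ge0 _ _).
  have ai : 0 < a i by rewrite lt0r ai0 a0.
  have := @level_energy_le R n p s0 s (w i) n_gt0 (ltW p1) s0_gt0 s_itv (mw i)
    (A i) (A i.+1) (t i) (a i) (mA i) (mA i.+1).
  rewrite -/(energy _) eE !aE -!EFinM !lee_fin pqE.
  have w_out x : ~ A i x -> w i x = 0.
    by move=> /negP; rewrite -leNgt => ux; exact: truncate_eq0 (ltW (t0 i)) ux.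
  have w_in x : A i.+1 x -> w i x = t i.
    rewrite /A/= => ux; apply: truncate_eq (ltW (t0 i)) _.
    by move: ux; rewrite /t exprS mulrCA.
  move=> /(_ (lexx _) ai (ltW (t0 i)) w_out w_in)/le_trans; apply.
  by rewrite powRM ?exprn_ge0//  /K /sobolev_const !mulrA.
have a0N : c `^ q * a 0%N <= c `^ (q - p) * N.
  have cq : c `^ q = c `^ (q - p) * c `^ p.
    by rewrite -powRD ?subrK// (gt_eqF c0) implybT.
  rewrite cq -mulrA ler_wpM2l ?powR_ge0//.
  by have := tA 0%N; rewrite aE -EFinM lee_fin /t expr0 mulr1.
have eS : \sum_(i < m) e i <= E.
  by rewrite -lee_fin -sumEFin; under eq_bigr do rewrite -eE; exact: sumw.
have p0q : 0 < p < q by rewrite p0.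
have S := @level_sum_le R p q c K E a e m p0q c0 (ltW sobolev_const_gt0) E0 a0 e0 eS step.
under eq_bigr do rewrite -/(t _) -/(A _) aE -EFinM.
rewrite sumEFin lee_fin.
apply: (@le_trans _ _ (2 `^ q * \sum_(i < m) t i `^ q * a i)).
  rewrite mulr_sumr; apply: ler_sum => i _.
  by rewrite powRM// ?(ltW (t0 i))// mulrA.
rewrite ler_wpM2l ?powR_ge0// (le_trans S)// lerD2l ler_pM2l//.
Qed.

Lemma sobolev_borel : (\int[lebn]_x (`|u x| `^ p)%:E < +oo)%E ->
  ((\int[lebn]_x (`|u x| `^ q)%:E) `^ (p / q) <=
   (2 `^ p * (2 * (2 `^ q * K)))%:E * energy u)%E.
Proof.
move=> ufin.
have C0 : 0 < 2 `^ p * (2 * (2 `^ q * K)).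
  by rewrite mulr_gt0 ?powR_gt0// mulr_gt0// mulr_gt0 ?powR_gt0//; exact: sobolev_const_gt0.
have /orP[/eqP ->|Efin] : (energy u == +oo)%E || (energy u \is a fin_num).
  by have := energy_ge0 u; case: (energy u) => [r| |] //=; rewrite ?orbT.
  by rewrite gt0_muley ?leey// lte_fin.
pose E := fine (energy u).
have EE : energy u = E%:E by rewrite fineK.
have E0 : 0 <= E by apply: fine_ge0.
have N0 : (0 <= \int[lebn]_x (`|u x| `^ p)%:E)%E.
  by apply: integral_ge0 => x _; rewrite lee_fin powR_ge0.
pose N := fine (\int[lebn]_x (`|u x| `^ p)%:E).
have NE : (\int[lebn]_x (`|u x| `^ p)%:E = N%:E)%E by rewrite fineK// ge0_fin_numE.
have {}N0 : 0 <= N by exact: fine_ge0.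
set X := 2 * (2 `^ q * K * E).
have X0 : 0 <= X.
  apply: mulr_ge0 => //; apply: mulr_ge0 => //; apply: mulr_ge0; first exact: powR_ge0.
  exact: ltW sobolev_const_gt0.
have bound : (\int[lebn]_x (`|u x| `^ q)%:E <= (2 `^ q * X `^ (q / p))%:E)%E.
  apply/lee_addgt0Pr => e e0.
  (* [D] collects the coefficients of $c^{q-p}$: [N] from the set where $|u| \le c$ and $2 \cdot 2^q
     N$ from the level sum. With $c^{q-p} = e/D$ these terms add up to at most [e]; the [+ 1] keeps
     [D] positive when [N] is zero. *)
  pose D := N * (1 + 2 * 2 `^ q) + 1.
  have D0 : 0 < D by rewrite ltr_wpDl// mulr_ge0// addr_ge0// mulr_ge0// powR_ge0.
  pose c := (e / D) `^ (q - p)^-1.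
  have c0 : 0 < c by rewrite powR_gt0// divr_gt0.
  have cqp : c `^ (q - p) = e / D.
    by rewrite -powRrM mulVf ?powRr1 ?divr_ge0 ?(ltW e0) ?(ltW D0)// gt_eqF// subr_gt0.
  have -> : (\int[lebn]_x (`|u x| `^ q)%:E =
      \int[lebn]_(x in [set x | (`|u x| <= c)%R]) (`|u x| `^ q)%:E +
      \int[lebn]_(x in [set x | (c < `|u x|)%R]) (`|u x| `^ q)%:E)%E.
    rewrite -ge0_integral_setU//.
    - by congr (integral _ _ _); apply/seteqP; split => x //= _; case: (leP `|u x| c); [left|right].
    - exact: measurable_sublevel.
    - exact: measurable_superlevel.
    - exact: measurable_powR_norm.
    - by apply/disj_setPS => x [/= h1 h2]; move: h1; rewrite leNgt h2.
  apply: (@le_trans _ _ ((c `^ (q - p) * N)%:E +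
     (2 `^ q * (X `^ (q / p) + 2 * (c `^ (q - p) * N)))%:E)%E).
    apply: leeD.
      rewrite EFinM -NE; apply: sublevel_integral_le => //.
      by rewrite p0 ltW.
    apply: superlevel_integral_le => // m.
    by apply: superlevel_sum_le => //; rewrite ?NE ?EE.
  rewrite -!EFinD lee_fin cqp.
  have : e / D * (N * (1 + 2 * 2 `^ q)) <= e.
    rewrite mulrAC ler_pdivrMr// ler_pM2l// /D lerDl//.
  lra.
have I0 : (0 <= \int[lebn]_x (`|u x| `^ q)%:E)%E.
  by apply: integral_ge0 => x _; rewrite lee_fin powR_ge0.
have pq0 : 0 <= p / q by rewrite divr_ge0 ?(ltW p0) ?(ltW q0).
(* The power $p/q$ turns $2^q X^{q/p}$ into $2^p X$, which is linear in the energy. *)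
apply: (@le_trans _ _ ((2 `^ q * X `^ (q / p))%:E `^ (p / q))%E).
  apply: gt0_ler_poweR => //; rewrite in_itv/= leey andbT//.
  by rewrite lee_fin mulr_ge0// powR_ge0.
rewrite EE -EFinM poweR_EFin lee_fin.
rewrite powRM ?powR_ge0// -!powRrM.
have -> : q * (p / q) = p by field; rewrite gt_eqF.
have -> : q / p * (p / q) = 1 by field; rewrite !gt_eqF.
by rewrite powRr1// /X -!mulrA.
Qed.

End sobolev_borel.

(** * Borel modifications *)

Section off_null_sets.
Context d (T : measurableType d) {R : realType}.
Variable m : {measure set T -> \bar R}.
Import HBNNSimple.

(* No measurability of f and g is assumed: the integral is a lower integral. *)
Lemma eq_integral_off_null (N : set T) (f g : T -> \bar R) :
  measurable N -> m N = 0%E ->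
  (forall x, (0 <= f x)%E) -> (forall x, (0 <= g x)%E) ->
  (forall x, ~ N x -> f x = g x) ->
  (\int[m]_x f x = \int[m]_x g x)%E.
Proof.
move=> mN N0 f0 g0 fg.
suff le (f' g' : T -> \bar R) : (forall x, (0 <= f' x)%E) -> (forall x, (0 <= g' x)%E) ->
    (forall x, ~ N x -> f' x = g' x) -> (\int[m]_x f' x <= \int[m]_x g' x)%E.
  by apply/eqP; rewrite eq_le !le// => x /fg.
move=> {}f0 {}g0 {}fg; rewrite [leLHS]ge0_integralTE//.
apply: ge_ereal_sup => _ [h /= hf <-].
rewrite -[X in sintegral m X](patch_setT (fun=> 0)) -integral_nnsfun//.
have mh : measurable_fun setT (fun x => (h x)%:E) by exact/measurable_EFinP.
rewrite (ge0_negligible_integral mN measurableT mh _ N0); last first.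
  by move=> x _; rewrite lee_fin.
have mNC : measurable (~` N) by exact: measurableC.
rewrite setTD [leRHS]ge0_integralTE//.
(* Cutting [h] off on [N] preserves its integral and puts it below [g']. *)
apply: ereal_sup_ubound; exists (mul_nnsfun h (indic_nnsfun R mNC)) => /=.
  move=> x; rewrite /mindic indicE; have [/[!inE] /= xN|_] := boolP (x \in _).
    by rewrite mulr1 -fg.
  by rewrite mulr0.
rewrite -[X in sintegral m X](patch_setT (fun=> 0)) -integral_nnsfun//.
rewrite [RHS]integral_mkcond_indic; apply: eq_integral => x _.
by rewrite -EFinM.
Qed.

(** For each rational $r$ the set where $u > r$ is Borel up to a Borel null set. Off the union [M]
    of these countably many null sets the superlevel sets of [u] are Borel, and [v] is [u] set to
    zero on [M]. *)
Lemma lebesgue_measurable_modification (u : T -> R) :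
  (forall B : set R, measurable B -> completed_algebra_gen m (u @^-1` B)) ->
  exists v : T -> R, exists N : set T, [/\ measurable_fun setT v, measurable N,
    m N = 0%E & forall x, ~ N x -> u x = v x].
Proof.
move=> mu.
(* An enumeration of the rationals in which integers that code none are sent to 0. *)
pose r (i : nat) : R := ratr (odflt 0%R (@unpickle rat i)).
have rP (a b : R) : a < b -> exists i, a < r i < b.
  move=> ab; have [q qab] := rat_in_itvoo ab.
  by exists (pickle q); rewrite /r pickleK/=; move: qab; rewrite in_itv.
have BZ i : exists BM : set T * set T, [/\ measurable BM.1, measurable BM.2,
    m BM.2 = 0%E & forall x, ~ BM.2 x -> BM.1 x <-> r i < u x].
  have [B mB [Z [M [mM M0 ZM]] BZE]] := mu _ (measurable_itv `]r i, +oo[).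
  exists (B, M); split => // x /= Mx.
  have : (B `|` Z) x <-> r i < u x.
    by rewrite BZE /= in_itv/= andbT.
  move=> <-; split; first by left.
  by case=> // /ZM.
have [BM BMP] := choice BZ.
pose M := \bigcup_i (BM i).2.
have mM : measurable M by apply: bigcupT_measurable => i; have [] := BMP i.
have M0 : m M = 0%E.
  apply/negligibleP => //; apply: negligible_bigcup => i.
  by have [_ ? ? _] := BMP i; apply/negligibleP.
exists (fun x => if x \in M then 0 else u x), M; split => //; last first.
  by move=> x Mx; rewrite memNset.
apply: (measurability _ (RGenOInfty.measurableE R)) => // _ [_ [a ->] <-].
rewrite setTI.
(* [V i] is the set where $v > r_i$: as [v] is zero on [M], all of [M] belongs to it exactly when
   $r_i < 0$. *)
pose V i := if 0 <= r i then (BM i).1 `\` M else (BM i).1 `|` M.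
rewrite (_ : _ @^-1` _ = \bigcup_(i in [set i | a <= r i]) V i).
  apply: bigcup_measurable => i _; have [? _ _ _] := BMP i.
  by rewrite /V; case: ifP => _; [exact: measurableD|exact: measurableU].
have VP i x : V i x <-> r i < (if x \in M then 0 else u x).
  have [_ _ _ h] := BMP i.
  have [/[!inE] xM|/negP] := boolP (x \in M).
    rewrite /V; have [r0|r0] := leP 0 (r i).
      by split => // -[].
    by split => // _; right.
  rewrite inE => xM.
  have xMi : ~ (BM i).2 x by move=> ?; apply: xM; exists i.
  rewrite -(h x xMi) /V; case: ifP => _; split => //.
  - by case.
  - by case.
  - by left.
apply/seteqP; split => x /=; rewrite in_itv/= andbT.
  move=> /rP[i /andP[ai iv]]; exists i => /=; first exact: ltW.
  exact/VP.
by move=> [i /= ai /VP]; exact: le_lt_trans.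
Qed.

End off_null_sets.

Section energy_modification.
Context {R : realType} {n : nat}.
Local Notation leb := (@lebesgue_measure R).
Local Notation mR := (measurableTypeR R).
Local Notation lebn := (@lebesgue_Rn R n).
Variables (s : 'I_n -> R) (p : R).
Hypothesis s01 : forall k, 0 <= s k <= 1.

(** By [integral_mu_axes_shift], the integral over [x] of the mass given to [N] is a weighted
    integral over [h] of measures of translates of [N], hence zero; a nonnegative function with zero
    integral vanishes almost everywhere. *)
Lemma null_mu_axes (N : set (Rn R n)) : measurable N -> lebn N = 0%E ->
  exists M, [/\ measurable M, lebn M = 0%E &
    forall x, ~ M x -> mu_axes s p x N = 0%E].
Proof.
move=> mN N0.
pose F (x y : Rn R n) : \bar R := (\1_N y)%:E.
have mF : measurable_fun setT (fun z : Rn R n * Rn R n => F z.1 z.2).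
  apply/measurable_EFinP; apply: (measurableT_comp _ measurable_snd).
  exact: measurable_indic.
have F0 x y : (0 <= F x y)%E by rewrite lee_fin.
have mG := measurable_integral_mu_axes p s01 mF F0.
have GE x : (\int[mu_axes s p x]_y F x y = mu_axes s p x N)%E.
  by rewrite (@integral_indic _ _ _ (mu_axes s p x))// setIT.
have G0 x : (0 <= mu_axes s p x N)%E.
  by rewrite -GE; apply: integral_ge0 => [|y _]; [exact: s01|exact: F0].
have : (\int[lebn]_x `|\int[mu_axes s p x]_y F x y| = 0)%E.
  transitivity (\int[lebn]_x \int[mu_axes s p x]_y F x y)%E.
    by apply: eq_integral => x _; rewrite GE gee0_abs.
  rewrite (integral_mu_axes_shift p s01 mF F0) big1// => k _.
  rewrite integral0_eq ?mule0// => h _.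
  suff -> : (\int[lebn]_x F x (axis_shift k h x) = 0)%E by rewrite mul0e.
  rewrite -N0 -[in RHS](setIT N) -integral_indic//.
  rewrite -(@ge0_integral_translate_Rn _ _ (fun i => if i == k then h else 0)
    (fun x => (\1_N x)%:E))//.
  - by apply: eq_integral => x _; rewrite -axis_shiftE.
  - by apply/measurable_EFinP; exact: measurable_indic.
move=> /(ae_eq_integral_abs lebn measurableT mG)[M [mM M0 GM]].
exists M; split => // x Mx; rewrite -GE.
apply/eqP/negPn/negP => h; apply: Mx; apply: GM => /= /(_ I) h'.
by move: h; rewrite h' eqxx.
Qed.

(** Outside [N] and the exceptional set of [null_mu_axes], [u x = v x] and [N] is null for the inner
    measure, so [eq_integral_off_null] applies to the inner and then to the outer integral. *)
Lemma energy_modification (u v : Rn R n -> R) (N : set (Rn R n)) :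
  measurable N -> lebn N = 0%E -> (forall x, ~ N x -> u x = v x) ->
  (\int[lebn]_x \int[mu_axes s p x]_y (`|u x - u y| `^ p)%:E =
   \int[lebn]_x \int[mu_axes s p x]_y (`|v x - v y| `^ p)%:E)%E.
Proof.
move=> mN N0 uv.
have e0 (w : Rn R n -> R) x :
    (0 <= \int[mu_axes s p x]_y (`|w x - w y| `^ p)%:E)%E.
  apply: integral_ge0 => [|y _]; first exact: s01.
  by rewrite lee_fin powR_ge0.
have [M [mM M0 hM]] := null_mu_axes mN N0.
apply: (@eq_integral_off_null _ _ _ _ (N `|` M)).
- exact: measurableU.
- by rewrite measureU0.
- exact: e0.
- exact: e0.
move=> x /not_orP[Nx Mx].
apply: (@eq_integral_off_null _ _ _ _ N) => [| |y|y|y Ny].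
- exact: mN.
- exact: hM.
- by rewrite lee_fin powR_ge0.
- by rewrite lee_fin powR_ge0.
- by rewrite !uv.
Qed.

End energy_modification.

(** * The inequality for Lebesgue measurable functions *)

Lemma LnormE_EFin d (T : measurableType d) (R : realType)
    (m : {measure set T -> \bar R}) (q : R) (u : T -> R) :
  ('N[m]_(q%:E)[EFin \o u] = (\int[m]_x (`|u x| `^ q)%:E) `^ q^-1)%E.
Proof. by rewrite unlock. Qed.

Theorem theorem2p7 (R : realType) (n : nat) (p pstar s0 : R) :
  (0 < n)%N -> 0 < s0 < 1 ->
  exists2 C : R, 0 < C &
    forall s : 'I_n -> R, (forall k, s0 <= s k < 1) ->
    1 < p < n%:R / hmean s ->
    pstar = n%:R * p / (n%:R - p * hmean s) ->
    forall u : Rn R n -> R, V_axes s p u ->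
    ('N[lebesgue_Rn n]_(pstar%:E)[EFin \o u] `^ p <=
     C%:E * \int[lebesgue_Rn n]_x \int[mu_axes s p x]_y
              (`|u x - u y| `^ p)%:E)%E.
Proof.
move=> n0 /andP[s0_gt0 _].
(* The constant is chosen before [s], hence before [1 < p] is assumed. If $p \le 1$ that assumption
   is contradictory and any constant serves. *)
have [p1|p1] := ltP 1 p; last first.
  by exists 1 => // s _ /andP[/(le_lt_trans p1)]; rewrite ltxx.
pose C := 2 `^ p * (2 * (2 `^ pstar * sobolev_const (n := n) p pstar s0)).
have C0 : 0 < C.
  rewrite mulr_gt0 ?powR_gt0// mulr_gt0// mulr_gt0 ?powR_gt0//.
  exact: sobolev_const_gt0.
exists C => // s s_itv /andP[_ pn] pstarE u [mu ufin _].
have p0 : 0 < p := lt_trans ltr01 p1.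
have nR0 : 0 < n%:R :> R by rewrite ltr0n.
have H0 := sum_inv_gt0 n0 s0_gt0 s_itv.
have hm0 : 0 < hmean s by rewrite hmeanE divr_gt0.
have den0 : 0 < n%:R - p * hmean s by rewrite subr_gt0 -ltr_pdivlMr.
have pq : p < pstar.
  rewrite pstarE ltr_pdivlMr// mulrC ltr_pM2r// gtrBl mulr_gt0//.
have q0 : 0 < pstar := lt_trans p0 pq.
(* The definition of [pstar] says precisely that the exponent in the level set inequality is $1 -
   p/p_\star$. *)
have pqE : p * hmean s / n%:R = 1 - p / pstar.
  by rewrite pstarE; field; rewrite !gt_eqF.
have s01 k : 0 <= s k <= 1.
  by have /andP[h1 h2] := s_itv k; rewrite (ltW h2) (le_trans (ltW s0_gt0) h1).
(* Replacing [u] by a Borel function equal to it off a null set changes neither the norms nor the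
   energy. *)
have [v [N [mv mN N0 uv]]] := lebesgue_measurable_modification mu.
rewrite (energy_modification p s01 mN N0 uv).
have modE r : (\int[lebesgue_Rn n]_x (`|u x| `^ r)%:E =
    \int[lebesgue_Rn n]_x (`|v x| `^ r)%:E)%E.
  apply: (eq_integral_off_null mN N0).
  - by move=> x; rewrite lee_fin powR_ge0.
  - by move=> x; rewrite lee_fin powR_ge0.
  - by move=> x Nx; rewrite uv.
rewrite LnormE_EFin -poweRrM modE mulrC.
apply: sobolev_borel => //.
rewrite -modE; move: ufin; rewrite /finite_norm LnormE_EFin.
by apply: lty_poweRy; rewrite gt_eqF// invr_gt0.
Qed.
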